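(* Let $H$ be a complex Hilbert space, let $A,B\in\mathcal{B}(H)$ be strictly positive and let $\lambda\in(0,1)$. Then $$\frac{\sin(\lambda\pi)}{\lambda\pi}\int_0^1\left(\frac{t}{1-t}\right)^{\lambda}\left(\frac{A!_tB-A}{t}\right)dt=\frac{A\sharp_{\lambda}B-A}{\lambda},$$ where $A\sharp_\lambda B=A^{1/2}\big(A^{-1/2}BA^{-1/2}\big)^{\lambda}A^{1/2}$. That is, the Tsallis relative operator entropy defined for accretive operators coincides with the usual one when the operators are strictly positive.
   Context: $\mathcal{B}(H)$ is the algebra of bounded linear operators on $H$. A self-adjoint $A\in\mathcal{B}(H)$ is positive if $\langle Ax,x\rangle\ge 0$ for all $x\in H$, and strictly positive if it is positive and invertible. $A\in\mathcal{B}(H)$ is accretive if $\Re A=(A+A^* )/2$ is strictly positive. For accretive $A,B$ and $t\in(0,1)$, the $t$-weighted harmonic mean is $A!_tB:=\big((1-t)A^{-1}+tB^{-1}\big)^{-1}$. For accretive $A,B$ and $\lambda\in(0,1)$ the Tsallis relative operator entropy is defined by $\mathcal{T}_{\lambda}(A|B):=\frac{\sin(\lambda\pi)}{\lambda\pi}\int_0^1\left(\frac{t}{1-t}\right)^{\lambda}\left(\frac{A!_tB-A}{t}\right)dt$ (an improper integral converging in operator norm). For strictly positive $A,B$ the usual Tsallis relative operator entropy is $(A\sharp_\lambda B-A)/\lambda$, with powers taken in the continuous functional calculus. *)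

(* Defs.v *)
From HB Require Import structures.
From mathcomp Require Import all_boot all_order all_algebra.
From mathcomp Require Import sesquilinear complex.
From mathcomp Require Import all_classical all_reals all_analysis.

Set Implicit Arguments.
Unset Strict Implicit.
Unset Printing Implicit Defensive.

Import Order.TTheory GRing.Theory Num.Theory.
Import numFieldNormedType.Exports.

Local Open Scope classical_set_scope.
Local Open Scope complex_scope.
Local Open Scope ring_scope.

(* The inner product is linear in its first argument and conjugate-linear in
   the second one. *)
HB.mixin Record CompleteNormedModule_isHilbert (R : realType) H
    & CompleteNormedModule R[i] H := {
  inner : {dot H for (@Num.conj R[i])} ;
  sqr_norm_inner : forall x : H, `|x| ^+ 2 = inner x x
}.

#[short(type="hilbertType")]
HB.structure Definition Hilbert (R : realType) :=
  {H of CompleteNormedModule R[i] H & CompleteNormedModule_isHilbert R H}.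

Definition bounded_linear (R : realType) (H : hilbertType R) (f : H -> H) :=
  linear f /\ exists M : R, forall x, `|f x| <= M%:C * `|x|.

Definition bop_pred (R : realType) (H : hilbertType R) : {pred H -> H} :=
  fun f => `[< bounded_linear f >].

(* The norm of H takes its values in R[i]; it is nonnegative, hence equal to
   its real part. *)
Lemma normRe (R : realType) (V : normedModType R[i]) (x : V) :
  `|x| = (complex.Re `|x|)%:C.
Proof. by rewrite RRe_real// realE normr_ge0. Qed.

Lemma Re_norm_ge0 (R : realType) (V : normedModType R[i]) (x : V) :
  0 <= complex.Re `|x|.
Proof. by rewrite -ler0c -normRe. Qed.

Section bounded_operators.
Variables (R : realType) (H : hilbertType R).

Lemma bounded_linear_ge0 (f : H -> H) : bounded_linear f ->
  exists2 M : R, 0 <= M & forall x, `|f x| <= M%:C * `|x|.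
Proof.
move=> [_ [M fM]]; exists `|M| => // x; apply: (le_trans (fM x)).
by rewrite ler_wpM2r// lecR ler_norm.
Qed.

Fact bop_submod_closed : submod_closed (@bop_pred R H).
Proof.
split=> [|a f g /asboolP Bf /asboolP Bg]; apply/asboolP.
  split=> [k x y|]; first by rewrite /= scaler0 addr0.
  by exists 0 => x; rewrite normr0 mul0r.
have [M M0 fM] := bounded_linear_ge0 Bf.
have [N N0 gN] := bounded_linear_ge0 Bg.
split=> [k x y|].
  rewrite !fctE /= Bf.1 Bg.1 !scalerDr !scalerA (mulrC k a).
  by rewrite !addrA; congr (_ + _); rewrite addrAC.
exists (complex.Re `|a| * M + N) => x.
rewrite !fctE (le_trans (ler_normD _ _))// normrZ rmorphD rmorphM/= mulrDl.
rewrite -(normRe (a : R[i]^o)) -mulrA lerD//.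
by rewrite ler_wpM2l.
Qed.

HB.instance Definition _ :=
  GRing.isSubmodClosed.Build R[i] (H -> H) (@bop_pred R H) bop_submod_closed.

Record bop := Bop { bop_fun :> H -> H ; bop_funP : bop_fun \in @bop_pred R H }.

HB.instance Definition _ := [isSub for bop_fun].
HB.instance Definition _ := [Choice of bop by <:].
HB.instance Definition _ := [SubChoice_isSubLmodule of bop by <:].

Lemma bopP (S T : bop) : S =1 T -> S = T.
Proof. by move=> ST; apply/val_inj/funext. Qed.

Lemma bop_bounded_linear (T : bop) : bounded_linear T.
Proof. exact/asboolP/bop_funP. Qed.

Lemma bopE0 (x : H) : (0 : bop) x = 0.
Proof. by []. Qed.

Lemma bopED (S T : bop) x : (S + T) x = S x + T x.
Proof. by []. Qed.

Lemma bopEZ (k : R[i]) (T : bop) x : (k *: T) x = k *: T x.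
Proof. by []. Qed.

HB.instance Definition _ (T : bop) :=
  GRing.isLinear.Build R[i] H H *:%R (T : H -> H) (bop_bounded_linear T).1.

Fact bop_one_subproof : id \in @bop_pred R H.
Proof. by apply/asboolP; split=> //; exists 1 => x; rewrite mul1r. Qed.

Fact bop_mul_subproof (S T : bop) : S \o T \in @bop_pred R H.
Proof.
apply/asboolP; split=> [k x y|]; first by rewrite /= !linearP.
have [M M0 SM] := bounded_linear_ge0 (bop_bounded_linear S).
have [N _ TN] := bounded_linear_ge0 (bop_bounded_linear T).
exists (M * N) => x; rewrite /= (le_trans (SM _))// rmorphM/= -mulrA.
by rewrite ler_wpM2l// ler0c.
Qed.

Definition bop_one : bop := Bop bop_one_subproof.
Definition bop_mul (S T : bop) : bop := Bop (bop_mul_subproof S T).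

Fact bop_mulA : associative bop_mul.
Proof. by move=> S T U; apply: bopP. Qed.
Fact bop_mul1l : left_id bop_one bop_mul.
Proof. by move=> S; apply: bopP. Qed.
Fact bop_mul1r : right_id bop_one bop_mul.
Proof. by move=> S; apply: bopP. Qed.
Fact bop_mulDl : left_distributive bop_mul +%R.
Proof. by move=> S T U; apply: bopP. Qed.
Fact bop_mulDr : right_distributive bop_mul +%R.
Proof. by move=> S T U; apply: bopP => x; exact: (linearD S). Qed.

(* The ring is not required to be nontrivial: H may be the zero space. *)
HB.instance Definition _ := GRing.Zmodule_isPzRing.Build bop
  bop_mulA bop_mul1l bop_mul1r bop_mulDl bop_mulDr.

Lemma bopE1 (x : H) : (1 : bop) x = x.
Proof. by []. Qed.

Lemma bopEM (S T : bop) x : (S * T) x = S (T x).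
Proof. by []. Qed.

Implicit Types S T : bop.

Definition opnorm (T : bop) : R :=
  sup [set complex.Re `|T x| | x in [set x : H | `|x| <= 1]].

Let ball_image (T : bop) := [set complex.Re `|T x| | x in [set x : H | `|x| <= 1]].

Let ball_image0 T : ball_image T 0.
Proof. by exists 0; rewrite /= ?linear0 normr0. Qed.

Let ball_image_sup T : has_sup (ball_image T).
Proof.
split; first by exists 0.
have [M M0 TM] := bounded_linear_ge0 (bop_bounded_linear T).
exists M => _ [x /= x1 <-]; rewrite -lecR -normRe (le_trans (TM x))//.
by rewrite -[leRHS]mulr1 ler_wpM2l// ler0c.
Qed.

Lemma opnorm_ge0 T : 0 <= opnorm T.
Proof. exact/ub_le_sup/ball_image0/(ball_image_sup T).2. Qed.

Lemma le_opnorm T x : `|T x| <= (opnorm T)%:C * `|x|.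
Proof.
have [->|x0] := eqVneq x 0; first by rewrite linear0 !normr0 mulr0.
have nx0 : 0 < `|x| by rewrite normr_gt0.
rewrite -ler_pdivrMr// mulrC -(ger0_norm (ltW nx0)) -normfV -normrZ -linearZ/=.
rewrite normRe lecR; apply: ub_le_sup; first exact: (ball_image_sup T).2.
by exists (`|x|^-1 *: x) => //=; rewrite normfZV.
Qed.

Lemma opnorm_le T M :
  0 <= M -> (forall x, `|T x| <= M%:C * `|x|) -> opnorm T <= M.
Proof.
move=> M0 TM; apply: ge_sup; first by exists 0; exact: ball_image0.
move=> _ [x /= x1 <-]; rewrite -lecR -normRe (le_trans (TM x))//.
by rewrite -[leRHS]mulr1 ler_wpM2l// ler0c.
Qed.

Let bop_norm (T : bop) : R[i] := (opnorm T)%:C.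

Fact ler_bop_normD S T : bop_norm (S + T) <= bop_norm S + bop_norm T.
Proof.
rewrite /bop_norm -rmorphD lecR; apply: opnorm_le => [|x].
  by rewrite addr_ge0// opnorm_ge0.
rewrite bopED (le_trans (ler_normD _ _))// rmorphD mulrDl.
by rewrite lerD// le_opnorm.
Qed.

Let opnormZ_le k T : bop_norm (k *: T) <= `|k| * bop_norm T.
Proof.
rewrite /bop_norm (normRe (k : R[i]^o)) -rmorphM lecR; apply: opnorm_le => [|x].
  by rewrite mulr_ge0 ?opnorm_ge0// (@Re_norm_ge0 R R[i]^o).
rewrite bopEZ normrZ rmorphM/= -(normRe (k : R[i]^o)) -mulrA.
by rewrite ler_wpM2l// le_opnorm.
Qed.

Fact bop_normZ (k : R[i]) T : bop_norm (k *: T) = `|k| * bop_norm T.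
Proof.
have [->|k0] := eqVneq k 0.
  apply/eqP; rewrite normr0 mul0r scale0r eq_le ler0c opnorm_ge0 andbT.
  by have := opnormZ_le 0 T; rewrite normr0 mul0r scale0r.
apply/eqP; rewrite eq_le opnormZ_le/=.
rewrite -ler_pdivlMl ?normr_gt0// -normfV.
by have := opnormZ_le k^-1 (k *: T); rewrite scalerA mulVf// scale1r.
Qed.

Fact bop_norm0_eq0 T : bop_norm T = 0 -> T = 0.
Proof.
move=> T0; apply: bopP => x; apply/eqP; rewrite -normr_le0.
by rewrite (le_trans (le_opnorm T x))// [_%:C]T0 mul0r.
Qed.

HB.instance Definition _ := Lmodule_isNormed.Build R[i] bop
  ler_bop_normD bop_normZ bop_norm0_eq0.

Lemma bop_normE (T : bop) : `|T| = (opnorm T)%:C.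
Proof. by []. Qed.

End bounded_operators.

Notation "''B' ( H )" := (bop H) (format "''B' ( H )") : type_scope.

Section positivity.
Variables (R : realType) (H : hilbertType R).
Implicit Types A B : 'B(H).

Definition is_adjoint A B := forall x y : H, inner (A x) y = inner x (B y).

Definition self_adjoint A := is_adjoint A A.

(* In R[i], 0 <= z states that z is real and nonnegative. *)
Definition positive_op A :=
  self_adjoint A /\ forall x : H, 0 <= (inner (A x) x : R[i]).

Definition is_inverse A B := A * B = 1 /\ B * A = 1.

Definition invertible_op A := exists B, is_inverse A B.

Definition strictly_positive A := positive_op A /\ invertible_op A.

(* xget 0 P is an element of P, or 0 when P is empty. *)
Definition inv_op A : 'B(H) := xget 0 [set B | is_inverse A B].

Definition harmonic_mean (t : R) A B : 'B(H) :=
  inv_op ((1 - t)%:C *: inv_op A + t%:C *: inv_op B).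

End positivity.

Section riemann_integral.
Variables (R : realType) (V : normedModType R[i]).
Implicit Types (F : R -> V) (a b : R) (I : V).

(* a = x 0 <= ... <= x n = b, with a tag xi i in each [x i, x i.+1]. *)
Definition tagged_partition a b n (x xi : nat -> R) :=
  [/\ x 0%N = a, x n = b &
      forall i, (i < n)%N -> x i <= xi i <= x i.+1].

Definition riemann_sum F n (x xi : nat -> R) : V :=
  \sum_(i < n) (x i.+1 - x i)%:C *: F (xi i).

Definition is_integral F a b I :=
  forall e : R, 0 < e -> exists2 d : R, 0 < d &
    forall n x xi, tagged_partition a b n x xi ->
      (forall i, (i < n)%N -> x i.+1 - x i < d) ->
      `|riemann_sum F n x xi - I| < e%:C.

Definition integral F a b : V := xget 0 [set I | is_integral F a b I].

(* F is integrable on the compact subintervals of ]a, b[, and the integrals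
   over [c, d] converge in norm to I as (c, d) -> (a+, b-). *)
Definition is_improper_integral F a b I :=
  (forall c d, a < c -> c <= d -> d < b -> exists J, is_integral F c d J) /\
  (integral F cd.1 cd.2 @[cd --> filter_prod a^'+ b^'-] --> I).

Definition improper_integral F a b : V :=
  xget 0 [set I | is_improper_integral F a b I].

End riemann_integral.

Section functional_calculus.
Variables (R : realType) (H : hilbertType R).
Implicit Types (X Y : 'B(H)) (f : R[i] -> R[i]).

Definition spectrum X : set R[i] :=
  [set z | ~ invertible_op (X - z *: (1 : 'B(H)))].

Definition poly_op (p : {poly R[i]}) X : 'B(H) :=
  \sum_(k < size p) p`_k *: X ^+ k.

(* For X self-adjoint and f continuous on the spectrum of X, f(X) is the norm
   limit of p_n(X) for polynomials p_n converging to f uniformly on the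
   spectrum; it does not depend on the choice of the p_n. *)
Definition is_cfc X f Y := exists p : nat -> {poly R[i]},
  (forall e : R, 0 < e -> \forall n \near \oo,
     forall z, spectrum X z -> `|(p n).[z] - f z| <= e%:C) /\
  (poly_op (p n) X @[n --> \oo] --> Y).

Definition cfc X f : 'B(H) := xget 0 [set Y | is_cfc X f Y].

(* Real power of a strictly positive operator, whose spectrum is contained in
   the positive real half-line. *)
Definition power_op X (r : R) : 'B(H) :=
  cfc X (fun z => (complex.Re z `^ r)%:C).

End functional_calculus.

Section tsallis_entropy.
Variables (R : realType) (H : hilbertType R).
Implicit Types (A B : 'B(H)) (lam : R).

Definition geometric_mean lam A B : 'B(H) :=
  power_op A (1 / 2) *
  power_op (power_op A (- (1 / 2)) * B * power_op A (- (1 / 2))) lam *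
  power_op A (1 / 2).

Definition tsallis_positive lam A B : 'B(H) :=
  (lam^-1)%:C *: (geometric_mean lam A B - A).

Definition tsallis_integrand lam A B (t : R) : 'B(H) :=
  ((t / (1 - t)) `^ lam)%:C *: ((t^-1)%:C *: (harmonic_mean t A B - A)).

Definition tsallis_accretive lam A B : 'B(H) :=
  (sin (lam * pi) / (lam * pi))%:C *:
    improper_integral (tsallis_integrand lam A B) 0 1.

End tsallis_entropy.

(* Main.v *)
Require Import Defs.
From mathcomp Require Import all_boot all_order all_algebra.
From mathcomp Require Import sesquilinear complex ring lra.
From mathcomp Require Import all_classical all_reals all_analysis.

Set Implicit Arguments.
Unset Strict Implicit.
Unset Printing Implicit Defensive.

Import Order.TTheory GRing.Theory Num.Theory.
Import numFieldNormedType.Exports.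
Local Open Scope classical_set_scope.
Local Open Scope complex_scope.
Local Open Scope ring_scope.

(** The whole integral is a function of one operator. Put [S = A^(1/2)],
    [T = A^(-1/2)] and [C = T B T]. Then [C] is strictly positive, [A = S S],
    [B = S C S], and the harmonic mean factors as [S g_t(C) S] with
    [g_t(x) = x / ((1 - t) x + t)] ([harmonic_meanE]). So the integrand is
    [S h_t(C) S], where [h_t(x) = (t / (1 - t))^lam (g_t(x) - 1) / t]
    ([tsallis_integrandE]).

    The continuous functional calculus of [C] is a ring morphism, contracting
    for the supremum over a segment [m, M] of the positive half-line containing
    the spectrum of [C] ([rcfcM], [rcfc_norm_le]). Hence every convergence of
    operators follows from the convergence of the corresponding functions of
    [x], provided that it is uniform for [x] in [m, M]: this covers the Riemann
    sums on [c, d] as well as the passage to the limits [c -> 0] and [d -> 1].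
    What has to be proved is thus the scalar identity
    [int_0^1 h_t(x) dt = k (x^lam - 1)] with [k = pi / sin(lam pi)], with rates
    uniform in [x].

    In the variable [u = ln(t / (1 - t))] the function [h_t(x)] has the explicit
    primitive [G_x = x^lam W(u - ln x) - W(u)], where [W] is the primitive of
    [e^(lam u) / (1 + e^u)] that vanishes at [-oo]. The mean value theorem turns
    Riemann sums into increments of [G_x] ([entropy_riemann_sum]); the bound
    [0 <= W(u) <= e^(lam u) / lam] gives the limit [0] at [t = 0], and, since
    [lam] and [1 - lam] are exchanged by [u -> -u], the limit
    [W(+oo) (x^lam - 1)] at [t = 1] ([entropy_prim_left],
    [entropy_prim_right]).

    It remains to see that [W(+oo) sin(lam pi) = pi] ([logistic_massE]). The
    geometric series and the symmetry [u -> -u] write [W(+oo)] as the sum over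
    all integers [n] of [(-1)^n / (lam + n)], which is the partial fraction
    expansion of the cosecant. The latter follows from integrating
    [cos(lam x)] against the Dirichlet kernel on [0, pi]
    ([csc_sum_cvg_rate]).

    The functional calculus rests on the inequality [|p(X)| <= sup |p|] over the
    spectrum of a self-adjoint [X] ([poly_op_norm_le]): [|p(X)|^2] is a spectral
    value of [p(X)^* p(X)], which is itself a polynomial in [X], so it is the
    value of [|p|^2] at a spectral value of [X]. That the spectrum of a strictly
    positive operator lies in some [m, M] with [0 < m] comes from the
    invertibility of coercive operators ([lax_milgram]). *)

(** * Mean value estimates and the partial fractions of the cosecant *)

Section mean_value.
Context {R : realType}.
Implicit Types (f g : R -> R) (a b : R).

Lemma mvt_is_derive f (df : R -> R) a b : a <= b ->
  (forall x, a <= x <= b -> is_derive x 1 f (df x)) ->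
  exists2 c, a <= c <= b & f b - f a = df c * (b - a).
Proof.
move=> ab fdf.
have fcont : {within `[a, b], continuous f}.
  apply: derivable_within_continuous => x; rewrite in_itv/= => /fdf xdf.
  exact: ex_derive.
have fdf' x : x \in `]a, b[ -> is_derive x 1 f (df x).
  by rewrite in_itv/= => /andP[ax xb]; apply: fdf; rewrite !ltW.
have [c] := MVT_segment ab fdf' fcont.
by rewrite in_itv/= => cab E; exists c.
Qed.

Lemma is_derive_le f g (df dg : R -> R) a b : a <= b ->
  (forall x, a <= x <= b -> is_derive x 1 f (df x)) ->
  (forall x, a <= x <= b -> is_derive x 1 g (dg x)) ->
  (forall x, a <= x <= b -> df x <= dg x) ->
  f b - f a <= g b - g a.
Proof.
move=> ab fdf gdg dfg.
have [|c cab E] := @mvt_is_derive (g \- f) (fun x => dg x - df x) a b ab.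
  by move=> x xab; have := gdg _ xab; have := fdf _ xab => *; apply: is_deriveB.
rewrite -subr_ge0 [leRHS](_ : _ = (g \- f) b - (g \- f) a); last by rewrite /=; ring.
by rewrite E mulr_ge0// subr_ge0// dfg.
Qed.

Lemma is_derive_norm_le f g (df dg : R -> R) a b : a <= b ->
  (forall x, a <= x <= b -> is_derive x 1 f (df x)) ->
  (forall x, a <= x <= b -> is_derive x 1 g (dg x)) ->
  (forall x, a <= x <= b -> `|df x| <= dg x) ->
  `|f b - f a| <= g b - g a.
Proof.
move=> ab fdf gdg dfg; rewrite ler_norml; apply/andP; split.
  rewrite lerNl.
  have -> : - (f b - f a) = (\- f) b - (\- f) a by rewrite /=; ring.
  apply: (@is_derive_le _ _ (\- df) dg) => // x xab.
    by have := fdf _ xab => ?; apply: is_deriveN.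
  by rewrite (le_trans _ (dfg _ xab))// -normrN ler_norm.
apply: (@is_derive_le _ _ df dg) => // x xab.
by rewrite (le_trans _ (dfg _ xab))// ler_norm.
Qed.

Lemma is_derive_lipschitz f (df : R -> R) K a b : a <= b ->
  (forall x, a <= x <= b -> is_derive x 1 f (df x)) ->
  (forall x, a <= x <= b -> `|df x| <= K) ->
  `|f b - f a| <= K * (b - a).
Proof.
move=> ab fdf dfK; rewrite mulrBr.
apply: (@is_derive_norm_le f ( *%R K) df (cst K)) => // x xab.
by apply: is_derive_eq; rewrite scaler1.
Qed.

End mean_value.

Section cosecant.
Context {R : realType}.
Variable lam : R.
Hypotheses (lam0 : 0 < lam) (lam1 : lam < 1).

Let lamn_neq0 (n : nat) : lam + n%:R != 0.
Proof. by rewrite gt_eqF// ltr_pwDl. Qed.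

Let lamBn_neq0 (n : nat) : lam - n.+1%:R != 0.
Proof. by rewrite lt_eqF// subr_lt0 (lt_le_trans lam1)// ler1n. Qed.

(** The symmetric partial sum, over [-N <= n <= N], of [(-1)^n / (lam + n)]. *)
Definition csc_sum (N : nat) : R :=
  lam^-1 + \sum_(n < N) (-1) ^+ n.+1 * ((lam + n.+1%:R)^-1 + (lam - n.+1%:R)^-1).

Let dirichlet (mu : R) (N : nat) (x : R) :=
  cos (mu * x) + \sum_(n < N) (cos ((mu + n.+1%:R) * x) + cos ((mu - n.+1%:R) * x)).

(** Multiplying by [sin (x / 2)] makes the sum telescope: each pair of terms is
    [2 cos (mu x) cos ((n + 1) x)]. *)
Lemma dirichletE (mu : R) (N : nat) (x : R) : dirichlet mu N x * sin (x / 2) =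
  cos (mu * x) * sin ((N%:R + 2^-1) * x).
Proof.
rewrite /dirichlet; elim: N => [|N IH].
  by rewrite big_ord0 addr0 add0r (mulrC _^-1).
rewrite big_ord_recr/= addrA mulrDl IH.
rewrite (mulrDl mu) (mulrBl x mu) cosD cosB.
set u := N.+1%:R * x; set v := x / 2.
have -> : (N%:R + 2^-1) * x = u - v by rewrite /u /v -natr1; field.
have -> : (N.+1%:R + 2^-1) * x = u + v by rewrite /u /v; field.
rewrite (sinD u v) (sinB u v); ring.
Qed.

Lemma is_derive_sinM (k x : R) : k != 0 ->
  is_derive x 1 (fun x => sin (k * x) / k) (cos (k * x)).
Proof.
move=> k0.
have H : is_derive x 1 (fun x => sin (k * x)) (cos (k * x) * k).
  have := @is_derive1_comp R sin ( *%R k) x _ _ (is_derive_sin _) _; apply.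
  by apply: is_derive_eq; rewrite scaler1.
rewrite [X in is_derive _ _ X](_ : _ = (k^-1 \*: (fun x => sin (k * x)))).
  by apply: is_derive_eq; rewrite /GRing.scale/=; field.
by apply/funext => y /=; rewrite mulrC.
Qed.

Lemma is_derive_cosM (k x : R) : is_derive x 1 (fun x => cos (k * x)) (- k * sin (k * x)).
Proof.
have -> : - k * sin (k * x) = - sin (k * x) * k by ring.
have := @is_derive1_comp R cos ( *%R k) x _ _ (is_derive_cos _) _; apply.
by apply: is_derive_eq; rewrite scaler1.
Qed.

Let tail (mu : R) (N : nat) (x : R) := \sum_(n < N)
   (sin ((mu + n.+1%:R) * x) / (mu + n.+1%:R) +
    sin ((mu - n.+1%:R) * x) / (mu - n.+1%:R)).

Let is_derive_tail (mu : R) (N : nat) (x : R) :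
  (forall n : nat, mu + n.+1%:R != 0) -> (forall n : nat, mu - n.+1%:R != 0) ->
  is_derive x 1 (tail mu N) (dirichlet mu N x - cos (mu * x)).
Proof.
move=> mup mun; rewrite /tail /dirichlet addrC addKr.
rewrite [X in is_derive _ _ X](_ : _ = \sum_(n < N) (fun x : R =>
  (sin ((mu + n.+1%:R) * x) / (mu + n.+1%:R) +
    sin ((mu - n.+1%:R) * x) / (mu - n.+1%:R)))); last first.
  by apply/funext => y; rewrite fct_sumE.
apply: is_derive_sum => n; apply: is_deriveD; exact: is_derive_sinM.
Qed.

(** The primitive of [(cos (lam x) - 1) D_N(x)] vanishing at [0], [D_N] being
    the Dirichlet kernel. Subtracting the case [lam = 0] removes the singularity
    of the kernel at [0]; at [pi] all the sines have a known value. *)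
Let U (N : nat) (x : R) := sin (lam * x) / lam + tail lam N x - (x + tail 0 N x).

Let is_derive_U (N : nat) (x : R) :
  is_derive x 1 (U N) (dirichlet lam N x - dirichlet 0 N x).
Proof.
have H1 := @is_derive_tail lam N x (fun n => lamn_neq0 n.+1) lamBn_neq0.
have H2 : is_derive x 1 (tail 0 N) (dirichlet 0 N x - cos (0 * x)).
  by apply: is_derive_tail => n; rewrite ?add0r ?sub0r ?oppr_eq0 pnatr_eq0.
have H3 : is_derive x 1 (fun x => sin (lam * x) / lam) (cos (lam * x)).
  by apply: is_derive_sinM; rewrite gt_eqF.
have := is_deriveB (is_deriveD H3 H1) (is_deriveD (is_derive_id x (1 : R)) H2).
by rewrite mul0r cos0 addrCA subrr addr0 addrCA subrr addr0; apply.
Qed.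

Let UE (N : nat) (x : R) : sin (x / 2) != 0 -> dirichlet lam N x - dirichlet 0 N x =
  (cos (lam * x) - 1) / sin (x / 2) * sin ((N%:R + 2^-1) * x).
Proof.
move=> s0; apply: (mulIf s0); rewrite mulrBl !dirichletE mul0r cos0; field.
exact: s0.
Qed.

(** This comparison is what bounds [phi] and its derivative near [0], where
    their denominators vanish; it uses [lam < 1]. *)
Let sin_half_le (x : R) : 0 <= x <= pi -> 0 <= sin (lam * x / 2) <= sin (x / 2).
Proof.
move=> /andP[x0 xpi]; have p0 := @pi_gt0 R.
have lx0 : 0 <= lam * x by rewrite mulr_ge0// ltW.
have lx : lam * x <= x by rewrite ler_piMl// ltW.
rewrite sin_ge0_pi/=; last by apply/andP; split; lra.
move: lx; rewrite le_eqVlt => /predU1P[->//|lx].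
by rewrite ltW// ltr_sin ?in_itv/=; [lra|apply/andP; split; lra..].
Qed.

Let cos_lam (x : R) : cos (lam * x) - 1 = - 2 * sin (lam * x / 2) ^+ 2.
Proof.
have -> : lam * x = (lam * x / 2) *+ 2 by rewrite -mulr_natr; field.
rewrite cos_mulr2n cos2sin2 -mulr_natr.
have -> : (lam * x / 2) *+ 2 / 2 = lam * x / 2 by rewrite -mulr_natr; field.
ring.
Qed.

Let sin_lam (x : R) : sin (lam * x) = 2 * sin (lam * x / 2) * cos (lam * x / 2).
Proof.
have {1}-> : lam * x = (lam * x / 2) *+ 2 by rewrite -mulr_natr; field.
rewrite sin_mulr2n -mulr_natr; ring.
Qed.

Let phi (x : R) := (cos (lam * x) - 1) / sin (x / 2).
Let dphi (x : R) := - lam * sin (lam * x) / sin (x / 2)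
  - (cos (lam * x) - 1) * cos (x / 2) / (2 * sin (x / 2) ^+ 2).

Let is_derive_phi (x : R) : sin (x / 2) != 0 -> is_derive x 1 phi (dphi x).
Proof.
move=> s0.
have H0 : is_derive x 1 (cst (1 : R)) 0 by exact: is_derive_cst.
have H1 := is_deriveB (is_derive_cosM lam x) H0.
have H2 : is_derive x 1 (fun x : R => sin (x / 2)) (cos (x / 2) / 2).
  have := @is_derive1_comp R sin ( *%R^~ 2^-1) x _ _ (is_derive_sin _) _; apply.
  rewrite [X in is_derive _ _ X](_ : _ = *%R 2^-1); last first.
    by apply/funext => y; rewrite mulrC.
  by apply: is_derive_eq; rewrite scaler1.
have H3 := is_deriveV s0 H2.
apply: (is_derive_eq (is_deriveM H1 H3)).
rewrite /dphi /GRing.scale /= !fctE/=; field; exact: s0.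
Qed.

Let phi_le (x : R) : 0 < x <= pi -> `|phi x| <= 2.
Proof.
move=> /andP[x0 xpi].
have s0 : 0 < sin (x / 2) by apply: sin_gt0_pi; apply/andP; split; lra.
have [|p0 p1] := andP (@sin_half_le x _); first by rewrite (ltW x0).
rewrite /phi normrM normfV (gtr0_norm s0) ler_pdivrMr// cos_lam.
rewrite normrM normrN normrX (ger0_norm p0) normr_nat ler_pM2l//.
have := sin_le1 (x / 2); nra.
Qed.

Let dphi_le (x : R) : 0 < x <= pi -> `|dphi x| <= 3.
Proof.
move=> /andP[x0 xpi].
have s0 : 0 < sin (x / 2) by apply: sin_gt0_pi; apply/andP; split; lra.
have [|p0 p1] := andP (@sin_half_le x _); first by rewrite (ltW x0).
rewrite /dphi (le_trans (ler_normB _ _))//.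
have -> : 3 = 2 + 1 :> R by ring.
apply: lerD.
  rewrite !normrM normfV (gtr0_norm s0) ler_pdivrMr// normrN (gtr0_norm lam0).
  rewrite sin_lam !normrM normr_nat (ger0_norm p0).
  have c0 := normr_ge0 (cos (lam * x / 2)); have := cos_max (lam * x / 2).
  have := ltW lam1; move: p1 p0 lam0 c0; set a := sin _; set b := sin _.
  set c := `|_| => ab a0 l0 c0 l1 c1.
  have ac : a * c <= b by rewrite (le_trans _ ab)// ler_piMr.
  rewrite (_ : lam * _ = 2 * (lam * (a * c))); last by ring.
  by rewrite ler_pM2l// (le_trans _ ac)// ler_piMl// mulr_ge0.
rewrite cos_lam; have := cos_max (x / 2).
move: s0 p1 p0; set b := sin (x / 2); set a := sin _; set c := cos _ => b0 ab a0 c1.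
rewrite (_ : -2 * _ * _ / _ = - ((a / b) ^+ 2 * c)); last by field; rewrite gt_eqF.
rewrite normrN normrM ger0_norm ?sqr_ge0// mulr_ile1 ?sqr_ge0// expr_le1//.
  by rewrite ler_pdivrMr// mul1r.
by rewrite divr_ge0// ltW.
Qed.

Let U0 N : U N 0 = 0.
Proof.
rewrite /U /tail mulr0 sin0 mul0r !add0r !big1 ?subrr// => i _.
all: by rewrite !mulr0 sin0 !mul0r addr0.
Qed.

(** Riemann-Lebesgue by one integration by parts: adding [phi B], where [B] is
    minus the primitive of the oscillating factor, leaves the derivative
    [phi' B], and [B] is of size [1 / N]. The endpoint [e] stays away from [0],
    where the quotient [phi] has a vanishing denominator. The constant bounds
    [2 + 2 + 3 pi]: two boundary terms, and [|phi'| <= 3] on [0, pi]. *)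
Let U_le N (e : R) : 0 < e <= pi -> `|U N pi - U N e| <= 16 / (N%:R + 2^-1).
Proof.
move=> /andP[e0 epi].
have k0 : 0 < N%:R + 2^-1 :> R by rewrite ltr_wpDl.
set k := _ + _ in k0 *.
have p0 := @pi_gt0 R.
have p4 : pi <= 4 :> R by have := @pihalf_lt2 R; lra.
pose B (x : R) := cos (k * x) / k.
have BE x : `|B x| <= k^-1.
  by rewrite /B normrM normfV (gtr0_norm k0) ler_piMl ?cos_max// invr_ge0 ltW.
have sx0 (x : R) : e <= x <= pi -> sin (x / 2) != 0.
  by move=> /andP[ex xp]; rewrite gt_eqF//; apply: sin_gt0_pi; apply/andP; split; lra.
have dV (x : R) : e <= x <= pi -> is_derive x 1 (U N \+ phi \* B) (dphi x * B x).
  move=> xe; have s0 := sx0 _ xe.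
  have H1 := is_derive_U N x; have H2 := is_derive_phi s0.
  have H3 : is_derive x 1 B (- sin (k * x)).
    have H := is_deriveZ k^-1 (is_derive_cosM k x).
    rewrite [X in is_derive _ _ X](_ : _ = (k^-1 \*: (fun x => cos (k * x)))).
      by apply: is_derive_eq; rewrite /GRing.scale/=; field; rewrite gt_eqF.
    by apply/funext => y /=; rewrite /B mulrC.
  apply: (is_derive_eq (is_deriveD H1 (is_deriveM H2 H3))).
  rewrite UE// /GRing.scale/= -/(phi x) -/k; ring.
have := @is_derive_lipschitz R _ _ (3 / k) e pi epi dV.
have dVle x : e <= x <= pi -> `|dphi x * B x| <= 3 / k.
  move=> /andP[ex xp]; rewrite normrM ler_pM// dphi_le//.
  by rewrite xp (lt_le_trans e0 ex).
move=> /(_ dVle) /= H.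
have pB x : e <= x <= pi -> `|phi x * B x| <= 2 / k.
  move=> /andP[ex xp]; rewrite normrM ler_pM// phi_le//.
  by rewrite xp (lt_le_trans e0 ex).
have Hp : `|phi pi * B pi| <= 2 / k by apply: pB; rewrite lexx epi.
have He : `|phi e * B e| <= 2 / k by apply: pB; rewrite lexx epi.
rewrite (_ : _ - _ = (U N pi + phi pi * B pi - (U N e + phi e * B e))
   - phi pi * B pi + phi e * B e); last by ring.
rewrite (le_trans (ler_normD _ _))// (_ : 16 / k = 14 / k + 2 / k); last first.
  by by rewrite -mulrDl -natrD.
apply: lerD; last exact: He.
rewrite (le_trans (ler_normB _ _))// (_ : 14 / k = 12 / k + 2 / k); last first.
  by by rewrite -mulrDl -natrD.
apply: lerD; last exact: Hp.
rewrite (le_trans H)// (_ : 3 / k * (pi - e) = 3 * (pi - e) / k); last by ring.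
rewrite ler_pM2r ?invr_gt0// (_ : 12 = 3 * 4); last by rewrite -natrM.
by rewrite ler_pM2l// lerBlDr ler_wpDr// ltW.
Qed.

Let U_pi N : U N pi = sin (lam * pi) * csc_sum N - pi.
Proof.
have sinn (n : nat) (x : R) : sin (x + n%:R * pi) = (-1) ^+ n * sin x.
  by rewrite mulrC mulr_natr (alternatingn (@sinDpi R)).
have sinB (n : nat) (x : R) : sin (x - n%:R * pi) = (-1) ^+ n * sin x.
  by rewrite -[in RHS](subrK (n%:R * pi) x) sinn mulrA -expr2 sqrr_sign mul1r.
have T0 : tail 0 N pi = 0.
  rewrite /tail big1// => n _.
  by rewrite !(mulrDl, mulrBl) mulNr mul0r sinn sinB sin0 !mulr0 !mul0r addr0.
rewrite /U T0 addr0 /csc_sum (mulrDr (sin (lam * pi)) lam^-1) mulr_sumr.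
congr (_ + _ - _); apply: eq_bigr => n _.
rewrite (mulrDl lam) (mulrBl pi lam) sinn sinB; ring.
Qed.

(** The value of [U N] at [pi] is [sin (lam pi)] times the partial sum, minus
    [pi]; it is small because [U N] vanishes at [0] and oscillates fast. *)
Lemma csc_sum_cvg_rate N :
  `|sin (lam * pi) * csc_sum N - pi| <= 16 / (N%:R + 2^-1).
Proof.
rewrite -U_pi; apply/ler_addgt0Pl => e e0.
have p0 := @pi_gt0 R.
have cU : {for 0, continuous (U N)}.
  apply: differentiable_continuous; apply/derivable1_diffP.
  by have := is_derive_U N 0 => H; apply: ex_derive.
move/cvgrPdist_le: cU => /(_ e e0) /nbhs_ballP [d /= d0] dU.
set y := Num.min (d / 2) pi.
have y0 : 0 < y <= pi.
  by rewrite /y lt_min p0 ge_min lexx orbT divr_gt0.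
have := dU y; rewrite U0 sub0r normrN => Uy.
have {}Uy : `|U N y| <= e.
  apply: Uy; rewrite /ball/= sub0r normrN gtr0_norm; last by case/andP: y0.
  by rewrite gt_min ltr_pdivrMr// ltr_pMr// ltr1n.
rewrite -[U N pi](subrK (U N y)) (le_trans (ler_normD _ _))// addrC lerD//.
exact: U_le.
Qed.
End cosecant.

(** * A primitive of the logistic density *)

Section logistic_primitive.
Context {R : realType}.
Implicit Types lam u : R.
Notation mu := (@lebesgue_measure R).

Let integrand lam (q : R) : R := (1 + q `^ lam^-1)^-1.

(** The primitive of [e^(lam u) / (1 + e^u)] vanishing at [-oo]. The substitution
    [q = e^(lam u)] replaces an integral over a half-line by the integral of a
    bounded function over a segment. *)
Definition logistic_prim lam u : R :=
  lam^-1 * (\int[mu]_(q in `[0, expR (lam * u)]) integrand lam q).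

Let integrand_ge0 lam q : 0 <= integrand lam q.
Proof. by rewrite invr_ge0 addr_ge0// powR_ge0. Qed.

Let integrand_le1 lam q : integrand lam q <= 1.
Proof. by rewrite invf_le1 ?lerDl ?powR_ge0// ltr_wpDr// powR_ge0. Qed.

Let integrable_integrand lam (b : R) :
  mu.-integrable `[0, b] (EFin \o integrand lam).
Proof.
apply: measurable_bounded_integrable => //.
- by rewrite /= lebesgue_measure_itv/=; case: ifP => // _; rewrite ltry.
- apply: measurable_funTS.
  rewrite [X in measurable_fun _ X](_ : _ = (@powR R ^~ (-1)) \o
      ((cst 1) \+ (@powR R ^~ lam^-1))); last first.
    by apply/funext => q /=; rewrite /integrand powR_inv1// addr_ge0// powR_ge0.
  apply: measurableT_comp => //; exact: measurable_realfun.measurable_funD.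
- exists 1; split => // M M1 x _ /=.
  by rewrite ger0_norm ?integrand_ge0// (le_trans (integrand_le1 _ _))// ltW.
Qed.

Lemma logistic_prim_ge0 lam u : 0 < lam -> 0 <= logistic_prim lam u.
Proof.
move=> lam0; rewrite /logistic_prim mulr_ge0 ?invr_ge0 ?(ltW lam0)//.
by apply: Rintegral_ge0 => q _; exact: integrand_ge0.
Qed.

Lemma logistic_prim_le lam u : 0 < lam -> logistic_prim lam u <= expR (lam * u) / lam.
Proof.
move=> lam0; rewrite /logistic_prim mulrC ler_pM2r ?invr_gt0//.
set b := expR _.
rewrite [leRHS](_ : b = \int[mu]_(q in `[0, b]) 1); last first.
  rewrite Rintegral_cst//= lebesgue_measure_itv/= lte_fin expR_gt0/=.
  by rewrite subr0 mul1r.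
apply: le_Rintegral => //.
apply: measurable_bounded_integrable => //.
  by rewrite /= lebesgue_measure_itv/=; case: ifP => // _; rewrite ltry.
by exists 1; split => // M M1 x _ /=; rewrite normr1 ltW.
Qed.

Lemma is_derive_expRM (k u : R) :
  is_derive u 1 (fun u => expR (k * u)) (expR (k * u) * k).
Proof.
have := @is_derive1_comp R expR ( *%R k) u _ _ (is_derive_expR _) _; apply.
by apply: is_derive_eq; rewrite scaler1.
Qed.

Lemma is_derive_logistic_prim lam u : 0 < lam ->
  is_derive u 1 (logistic_prim lam) (expR (lam * u) / (1 + expR u)).
Proof.
move=> lam0; set p := expR (lam * u).
have p0 : 0 < p := expR_gt0 _.
have cp : {for p, continuous (integrand lam)}.
  apply: differentiable_continuous; apply/derivable1_diffP.
  pose g (q : R) := 1 + q `^ lam^-1.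
  have n0 : g p != 0 by rewrite gt_eqF// ltr_wpDr// powR_ge0.
  have H : is_derive p 1 g (0 + lam^-1 * p `^ (lam^-1 - 1)).
    have H := is_derive1_powR lam^-1 p0.
    have H0 : is_derive p 1 (cst (1 : R)) 0 by exact: is_derive_cst.
    exact: is_deriveD.
  have H1 := is_deriveV n0 H.
  exact: ex_derive.
have p1 : p < p + 1 by rewrite ltrDl.
have [dQ Q'] := continuous_FTC1_closed p1 (integrable_integrand lam (p + 1)) p0 cp.
have H1 : is_derive p 1 (fun b => \int[mu]_(q in `[0, b]) integrand lam q)
    (integrand lam p).
  apply: DeriveDef; first exact: dQ.
  by rewrite -derive1E; exact: Q'.
have H2 : is_derive u 1 (fun u => expR (lam * u)) (p * lam).
  exact: is_derive_expRM.
have H3 := is_deriveZ lam^-1 (@is_derive1_comp R _ (fun u => expR (lam * u)) u _ _ H1 H2).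
apply: (is_derive_eq H3).
rewrite /integrand /GRing.scale/=.
have -> : p `^ lam^-1 = expR u by rewrite /p -expRM mulrAC divff ?mul1r// gt_eqF.
by field; rewrite !gt_eqF// ltr_pwDl// expR_ge0.
Qed.

(** The remainder of the geometric series of ratio [- x]. *)
Let geometric (x : R) (N : nat) : 0 <= x ->
  (1 + x)^-1 - \sum_(n < N) (-1) ^+ n * x ^+ n = (-1) ^+ N * x ^+ N / (1 + x).
Proof.
move=> x0; have x1 : 1 + x != 0 by rewrite gt_eqF// ltr_pwDl.
elim: N => [|N IH]; first by rewrite big_ord0 !expr0 mul1r subr0 mul1r.
by rewrite big_ord_recr/= opprD addrA IH !exprS; field.
Qed.

(** Expand [1 / (1 + e^u)] in powers of [e^u] for [u <= 0] and integrate: the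
    remainder of the series is dominated by [e^((lam + N) u)], whose integral
    over the negative half-line is [1 / (lam + N)]. *)
Lemma logistic_prim0_rate lam (N : nat) : 0 < lam ->
  `|logistic_prim lam 0 - \sum_(n < N) (-1) ^+ n / (lam + n%:R)| <= (lam + N%:R)^-1.
Proof.
move=> lam0.
have ln0 (n : nat) : 0 < lam + n%:R by rewrite ltr_pwDl.
pose s (u : R) := \sum_(n < N) (-1) ^+ n * (expR ((lam + n%:R) * u) / (lam + n%:R)).
have dE (k u : R) : k != 0 -> is_derive u 1 (fun u => expR (k * u) / k) (expR (k * u)).
  move=> k0.
  rewrite [X in is_derive _ _ X](_ : _ = (k^-1 \*: (fun u => expR (k * u)))).
    by apply: (is_derive_eq (is_deriveZ k^-1 (is_derive_expRM k u)));
      rewrite /GRing.scale/=; field.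
  by apply/funext => y /=; rewrite mulrC.
have ds u : is_derive u 1 s (\sum_(n < N) (-1) ^+ n * expR ((lam + n%:R) * u)).
  rewrite /s [X in is_derive _ _ X](_ : _ = \sum_(n < N) (fun u : R =>
    (-1) ^+ n * (expR ((lam + n%:R) * u) / (lam + n%:R)))); last first.
    by apply/funext => y; rewrite fct_sumE.
  apply: is_derive_sum => n.
  have lnn : lam + n%:R != 0 by rewrite gt_eqF.
  exact: (is_deriveZ ((-1) ^+ n) (dE _ u lnn)).
pose K := lam^-1 + \sum_(n < N) (lam + n%:R)^-1.
have K0 : 0 < K.
  rewrite ltr_pwDl ?invr_gt0// sumr_ge0// => n _.
  by rewrite invr_ge0 ltW.
(* Both functions vanish at -oo, which fixes the constant of integration. *)
have small u : u <= 0 -> `|logistic_prim lam u - s u| <= K * expR (lam * u).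
  move=> u0; rewrite (le_trans (ler_normB _ _))// mulrDl; apply: lerD.
    by rewrite ger0_norm ?logistic_prim_ge0// mulrC logistic_prim_le.
  rewrite mulr_suml (le_trans (ler_norm_sum _ _ _))// ler_sum// => n _.
  rewrite normrM normrX normrN1 expr1n mul1r ger0_norm; last first.
    by rewrite divr_ge0 ?expR_ge0// ltW.
  by rewrite mulrC ler_pM2l ?invr_gt0// ler_expR mulrDl gerDl mulr_ge0_le0.
have rate u : u <= 0 -> `|logistic_prim lam 0 - s 0 - (logistic_prim lam u - s u)| <=
    (lam + N%:R)^-1.
  move=> u0.
  have := @is_derive_norm_le R (logistic_prim lam \- s)
    (fun u => expR ((lam + N%:R) * u) / (lam + N%:R))
    (fun u => expR (lam * u) / (1 + expR u) -
      (\sum_(n < N) (-1) ^+ n * expR ((lam + n%:R) * u)))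
    (fun u => expR ((lam + N%:R) * u)) u 0 u0.
  move=> H; apply: le_trans (H _ _ _) _.
  - by move=> x _; apply: is_deriveB; exact: is_derive_logistic_prim.
  - by move=> x _; apply: dE; rewrite gt_eqF.
  - move=> x _.
    have e1 : 0 < 1 + expR x by rewrite ltr_pwDl// expR_ge0.
    have -> : \sum_(n < N) (-1) ^+ n * expR ((lam + n%:R) * x) =
        expR (lam * x) * \sum_(n < N) (-1) ^+ n * expR x ^+ n.
      rewrite mulr_sumr; apply: eq_bigr => n _.
      by rewrite mulrDl expRD expRM_natl mulrCA.
    rewrite -mulrBr geometric ?expR_ge0// mulrDl expRD expRM_natl normrM.
    rewrite ger0_norm ?expR_ge0// ler_pM2l ?expR_gt0// !normrM normrX normrN1.
    rewrite expr1n mul1r normfV (gtr0_norm e1) ger0_norm ?exprn_ge0 ?expR_ge0//.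
    by rewrite ler_piMr ?exprn_ge0 ?expR_ge0// invf_le1// lerDl expR_ge0.
  by rewrite mulr0 expR0 mul1r gerBl divr_ge0 ?expR_ge0// ltW.
have s0 : s 0 = \sum_(n < N) (-1) ^+ n / (lam + n%:R).
  by apply: eq_bigr => n _; rewrite mulr0 expR0 mul1r.
rewrite -s0; apply/ler_addgt0Pl => e e0.
pose y : R := Num.min 1 (e / K).
have y0 : 0 < y by rewrite lt_min ltr01 divr_gt0.
pose u := ln y / lam.
have u0 : u <= 0.
  by rewrite /u ler_pdivrMr// mul0r ln_le0// /y ge_min lexx.
rewrite -[X in `|X|](subrK (logistic_prim lam u - s u)) addrC.
rewrite (le_trans (ler_normD _ _))// lerD ?rate// (le_trans (small _ u0))//.
rewrite /u (mulrC lam) divfK ?gt_eqF// lnK ?posrE//.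
by rewrite mulrC -ler_pdivlMr// ge_min lexx orbT.
Qed.

End logistic_primitive.

(** * The scalar Tsallis integral *)

Section entropy_primitive.
Context {R : realType}.
Implicit Types lam x t u : R.

(** The integral of [e^(lam u) / (1 + e^u)] over the whole line, its positive half
    being folded on the negative one by [u -> - u]. *)
Definition logistic_mass lam : R := logistic_prim lam 0 + logistic_prim (1 - lam) 0.

Lemma logistic_prim_reflect lam u : 0 < lam < 1 ->
  logistic_prim lam u = logistic_mass lam - logistic_prim (1 - lam) (- u).
Proof.
move=> /andP[lam0 lam1].
have lam10 : 0 < 1 - lam by rewrite subr_gt0.
pose f v := logistic_prim lam v + logistic_prim (1 - lam) (- v).
have df (v : R) : is_derive v 1 f 0.
  have H1 := is_derive_logistic_prim v lam0.
  have H2 := is_derive_logistic_prim (- v) lam10.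
  have H3 : is_derive v 1 (fun w : R => - w) (-1).
    by apply: is_deriveN.
  apply: (is_derive_eq (is_deriveD H1 (@is_derive1_comp R _ _ v _ _ H2 H3))).
  have -> : (1 - lam) * - v = lam * v - v by ring.
  rewrite expRD expRN.
  have := expR_gt0 v; move: (expR v) (expR (lam * v)) => a b a0.
  by field; rewrite !gt_eqF//; lra.
have := is_derive_0_is_cst u 0 df; rewrite /f oppr0 => fE.
by rewrite /logistic_mass -fE addrK.
Qed.

(** The expansions of the two halves are the terms [n >= 0] and [n < 0] of the
    partial fraction expansion of [pi / sin (lam pi)]. *)
Lemma logistic_massE lam : 0 < lam < 1 -> sin (lam * pi) * logistic_mass lam = pi.
Proof.
move=> lam01; have /andP[lam0 lam1] := lam01.
have lam10 : 0 < 1 - lam by rewrite subr_gt0.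
apply/eqP; rewrite -subr_eq0 -normr_eq0 eq_le normr_ge0 andbT.
apply/ler_addgt0Pl => e e0; rewrite addr0.
pose N := Num.trunc (18 / e).
have N0 : 0 < N.+1%:R :> R by [].
have Ne : 18 / N.+1%:R <= e.
  rewrite ler_pdivrMr// mulrC -ler_pdivrMr//.
  by rewrite ltW// truncnS_gt.
apply: le_trans Ne.
have csc : csc_sum lam N.+1 = \sum_(n < N.+2) (-1) ^+ n / (lam + n%:R)
    + \sum_(n < N.+1) (-1) ^+ n / (1 - lam + n%:R).
  rewrite [in RHS]big_ord_recl/= expr0 mul1r addr0 -addrA -big_split/=; congr (_ + _).
  apply: eq_bigr => n _; rewrite mulrDr; congr (_ + _).
  rewrite exprS mulN1r mulNr -mulrN -invrN; congr (_ / _).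
  by rewrite -natr1; ring.
have H1 := logistic_prim0_rate N.+2 lam0.
have H2 := logistic_prim0_rate N.+1 lam10.
have H3 := csc_sum_cvg_rate lam0 lam1 N.+1.
set s1 := \sum_(n < N.+2) _ in csc H1; set s2 := \sum_(n < N.+1) _ in csc H2.
rewrite csc in H3.
have split_error (c a b x y p : R) :
    c * (a + b) - p = c * (a - x) + c * (b - y) + (c * (x + y) - p) by ring.
have le1 (a b : R) : `|a| <= b -> `|sin (lam * pi) * a| <= b.
  by move=> ab; rewrite normrM (le_trans _ ab)// ler_piMl// sin_max.
rewrite (split_error _ _ _ s1 s2) (_ : 18 = 1 + 1 + 16); last by ring.
rewrite [leRHS]mulrDl [X in _ <= X + _]mulrDl.
rewrite (le_trans (ler_normD _ _))// lerD//; last first.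
  by rewrite (le_trans H3)// ler_pM2l// lef_pV2 ?posrE ?lerDl ?addr_gt0.
rewrite (le_trans (ler_normD _ _))// lerD//.
  rewrite (le_trans (le1 _ _ H1))// mul1r lef_pV2 ?posrE ?addr_gt0//.
  by rewrite (@le_trans _ _ N.+2%:R) ?ler_nat// lerDr ltW.
have p2 : 0 < 1 - lam + N.+1%:R by rewrite (addr_gt0 lam10).
rewrite (le_trans (le1 _ _ H2))// mul1r lef_pV2 ?posrE//.
by rewrite lerDr ltW.
Qed.

Definition log_odds t : R := ln (t / (1 - t)).

(** In the variable [u = ln (t / (1 - t))] the form [h_t(x) dt] is the difference
    of [e^(lam u) x / (x + e^u) du] and [e^(lam u) / (1 + e^u) du], and the first
    one is [x^lam] times the translate of the second by [ln x]. *)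
Definition entropy_prim lam x t : R :=
  x `^ lam * logistic_prim lam (log_odds t - ln x) - logistic_prim lam (log_odds t).

Definition entropy_integrand lam x t : R :=
  (t / (1 - t)) `^ lam * (t^-1 * (x / ((1 - t) * x + t) - 1)).

Let odds_gt0 t : 0 < t < 1 -> 0 < t / (1 - t).
Proof. by move=> /andP[t0 t1]; rewrite divr_gt0// subr_gt0. Qed.

Lemma is_derive_log_odds t : 0 < t < 1 ->
  is_derive t 1 log_odds (t * (1 - t))^-1.
Proof.
move=> t01; have o0 := odds_gt0 t01; have /andP[t0 t1] := t01.
pose g (t : R) := 1 - t.
have n0 : g t != 0 by rewrite gt_eqF// subr_gt0.
have H1 : is_derive t 1 g (0 - 1) by apply: is_deriveB.
have H2 : is_derive t 1 (fun t : R => t / (1 - t)) ((1 - t) ^- 2).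
  apply: (is_derive_eq (is_deriveM (is_derive_id t (1 : R)) (is_deriveV n0 H1))).
  rewrite /GRing.scale/= /g; field; exact: n0.
have H3 := is_derive1_ln o0.
have H4 : is_derive t 1 log_odds ((t / (1 - t))^-1 * (1 - t) ^- 2).
  exact: (is_derive1_comp (g := fun t : R => t / (1 - t)) H3 H2).
apply: (is_derive_eq H4).
by field; rewrite !gt_eqF ?subr_gt0.
Qed.

Lemma is_derive_entropy_prim lam x t : 0 < lam -> 0 < x -> 0 < t < 1 ->
  is_derive t 1 (entropy_prim lam x) (entropy_integrand lam x t).
Proof.
move=> lam0 x0 t01; have o0 := odds_gt0 t01; have /andP[t0 t1] := t01.
have H1 := is_derive_log_odds t01.
have H2 : is_derive t 1 (fun t => log_odds t - ln x) ((t * (1 - t))^-1 - 0).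
  by have H0 := is_derive_cst (ln x) t (1 : R); apply: is_deriveB.
have H3 := is_derive_logistic_prim (log_odds t - ln x) lam0.
have H4 := is_derive_logistic_prim (log_odds t) lam0.
have H5 := is_deriveZ (x `^ lam) (@is_derive1_comp R _ _ t _ _ H3 H2).
have H6 := @is_derive1_comp R _ _ t _ _ H4 H1.
apply: (is_derive_eq (is_deriveB H5 H6)).
rewrite /entropy_integrand /GRing.scale/= subr0.
have -> : expR (log_odds t) = t / (1 - t) by rewrite lnK.
have -> : expR (log_odds t - ln x) = t / (1 - t) / x.
  by rewrite expRB !lnK.
have -> : expR (lam * (log_odds t - ln x)) = (t / (1 - t)) `^ lam / x `^ lam.
  by rewrite mulrBr expRB /powR !gt_eqF.
have -> : expR (lam * log_odds t) = (t / (1 - t)) `^ lam.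
  by rewrite /powR gt_eqF.
have := powR_gt0 lam x0; move: (x `^ lam) (_ `^ lam) => a b a0.
have s0 : 0 < 1 - t by rewrite subr_gt0.
have d0 : 0 < (1 - t) * x + t by rewrite ltr_wpDl// mulr_ge0 ?ltW.
by field; rewrite subrK oner_eq0 !gt_eqF.
Qed.

(** The factor [x^lam] cancels the translation by [ln x], so that the bound does
    not depend on [x]. *)
Lemma entropy_prim_left lam x t : 0 < lam -> 0 < x -> 0 < t < 1 ->
  `|entropy_prim lam x t| <= 2 / lam * (t / (1 - t)) `^ lam.
Proof.
move=> lam0 x0 t01; have o0 := odds_gt0 t01.
have E : expR (lam * log_odds t) = (t / (1 - t)) `^ lam.
  by rewrite /powR gt_eqF.
have xl := powR_gt0 lam x0.
rewrite (_ : 2 / lam * _ =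
  (t / (1 - t)) `^ lam / lam + (t / (1 - t)) `^ lam / lam); last by ring.
rewrite (le_trans (ler_normB _ _))// lerD//; last first.
  by rewrite ger0_norm ?logistic_prim_ge0// -E logistic_prim_le.
rewrite normrM gtr0_norm// ger0_norm ?logistic_prim_ge0//.
rewrite mulrC -ler_pdivlMr// (le_trans (logistic_prim_le _ lam0))//.
have -> : expR (lam * (log_odds t - ln x)) = (t / (1 - t)) `^ lam / x `^ lam.
  by rewrite mulrBr expRB E [X in _ = _ / X]/powR gt_eqF.
by rewrite mulrAC.
Qed.

(** Reflecting both terms turns the behaviour at [t = 1] into the one at [t = 0],
    with [1 - lam] in place of [lam]. *)
Lemma entropy_prim_right lam x t : 0 < lam < 1 -> 0 < x -> 0 < t < 1 ->
  `|entropy_prim lam x t - logistic_mass lam * (x `^ lam - 1)| <=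
  (x + 1) / (1 - lam) * ((1 - t) / t) `^ (1 - lam).
Proof.
move=> lam01 x0 t01; have o0 := odds_gt0 t01; have /andP[lam0 lam1] := lam01.
have lam10 : 0 < 1 - lam by rewrite subr_gt0.
have /andP[t0 t1] := t01.
have o1 : 0 < (1 - t) / t by rewrite divr_gt0// subr_gt0.
have E : expR ((1 - lam) * - log_odds t) = ((1 - t) / t) `^ (1 - lam).
  by rewrite /powR gt_eqF// /log_odds -lnV ?posrE// invf_div.
have xl := powR_gt0 lam x0.
rewrite /entropy_prim !(logistic_prim_reflect _ lam01).
have regroup (k y p q : R) : y * (k - p) - (k - q) - k * (y - 1) = q - y * p by ring.
rewrite regroup.
rewrite (le_trans (ler_normB _ _))// addrC mulrDl mulrDl lerD//; last first.
  rewrite ger0_norm ?logistic_prim_ge0// (le_trans (logistic_prim_le _ lam10))//.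
  by rewrite E mulrC mul1r.
rewrite normrM gtr0_norm// ger0_norm ?logistic_prim_ge0//.
rewrite mulrC -ler_pdivlMr// (le_trans (logistic_prim_le _ lam10))//.
have -> : expR ((1 - lam) * - (log_odds t - ln x)) =
    ((1 - t) / t) `^ (1 - lam) * (x / x `^ lam).
  have -> : (1 - lam) * - (log_odds t - ln x) =
    (1 - lam) * - log_odds t + (ln x - lam * ln x) by ring.
  by rewrite expRD E expRB lnK// [X in _ = _ * (_ / X)]/powR gt_eqF.
move: (_ `^ (1 - lam)) (x `^ lam) => a b.
by rewrite (_ : a * (x / b) / (1 - lam) = x / (1 - lam) * a / b)//; ring.
Qed.

Lemma continuous_entropy_prim lam x t : 0 < lam -> 0 < x ->
  {for x, continuous (entropy_prim lam ^~ t)}.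
Proof.
move=> lam0 x0; apply: differentiable_continuous; apply/derivable1_diffP.
have H1 := is_derive1_powR lam x0.
have H2 := is_derive_logistic_prim (log_odds t - ln x) lam0.
have H3 : is_derive x 1 (fun x => log_odds t - ln x) (0 - x^-1).
  have H0 := is_derive_cst (log_odds t) x (1 : R).
  by have := is_derive1_ln x0 => ?; apply: is_deriveB.
have H4 := @is_derive1_comp R _ _ x _ _ H2 H3.
have H5 := is_deriveM H1 H4.
have H0 := is_derive_cst (logistic_prim lam (log_odds t)) x (1 : R).
have := is_deriveB H5 H0 => H.
exact: ex_derive.
Qed.

End entropy_primitive.

(** * Uniform convergence of the scalar Riemann sums *)

Section riemann_sums.
Context {R : realType}.

Lemma tagged_partition_mono (a b : R) n (x xi : nat -> R) i j :
  tagged_partition a b n x xi -> (i <= j <= n)%N -> x i <= x j.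
Proof.
move=> [_ _ xxi] /andP[]; elim: j => [|j IH]; first by rewrite leqn0 => /eqP ->.
rewrite leq_eqVlt ltnS => /predU1P[->//|ij jn].
rewrite (le_trans (IH ij (ltnW jn)))//.
by have /andP[] := xxi _ jn => /le_trans; apply.
Qed.

(** On each cell the mean value theorem writes the increment of [F] as the
    length of the cell times a value of [f] there; the tag contributes another
    value of [f] on the same cell. *)
Lemma riemann_sum_primitive (F f : R -> R) (K c d delta : R) n (x xi : nat -> R) :
  0 <= K ->
  (forall t, c <= t <= d -> is_derive t 1 F (f t)) ->
  (forall s t, c <= s <= d -> c <= t <= d -> `|f s - f t| <= K * `|s - t|) ->
  tagged_partition c d n x xi ->
  (forall i, (i < n)%N -> x i.+1 - x i < delta) ->
  `|\sum_(i < n) (x i.+1 - x i) * f (xi i) - (F d - F c)| <= K * delta * (d - c).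
Proof.
move=> K0 dF lipf xxi mesh; have [x0 xn xP] := xxi.
have xle i j : (i <= j <= n)%N -> x i <= x j := tagged_partition_mono xxi.
have -> : F d - F c = \sum_(i < n) (F (x i.+1) - F (x i)).
  by rewrite -(big_mkord xpredT (fun i => F (x i.+1) - F (x i))) telescope_sumr// x0 xn.
have -> : d - c = \sum_(i < n) (x i.+1 - x i).
  by rewrite -(big_mkord xpredT (fun i => x i.+1 - x i)) telescope_sumr// x0 xn.
rewrite -sumrB mulr_sumr (le_trans (ler_norm_sum _ _ _))// ler_sum// => -[i ilt] _ /=.
have /andP[xl xr] := xP _ ilt.
have xx : x i <= x i.+1 := le_trans xl xr.
have cd t : x i <= t <= x i.+1 -> c <= t <= d.
  move=> /andP[tl tr]; rewrite -x0 -xn; apply/andP; split.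
    by rewrite (le_trans _ tl)// xle//= ltnW.
  by rewrite (le_trans tr)// xle// ilt/=.
have [z zx ->] := mvt_is_derive xx (fun t tx => dF t (cd t tx)).
rewrite mulrC -mulrBl normrM (ger0_norm (_ : 0 <= x i.+1 - x i)) ?subr_ge0//.
rewrite ler_wpM2r ?subr_ge0// (le_trans (lipf _ _ _ _))//.
- by apply: cd; rewrite xl.
- exact: cd.
rewrite ler_wpM2l// (le_trans _ (ltW (mesh _ ilt)))//.
by case/andP: zx => z1 z2; rewrite ler_norml; apply/andP; split; lra.
Qed.

End riemann_sums.

Section entropy_riemann_sums.
Context {R : realType}.
Variables lam c d m M : R.
Hypotheses (lam01 : 0 < lam < 1) (c0 : 0 < c) (cd : c <= d) (d1 : d < 1)
  (m0 : 0 < m).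

Let lam0 : 0 < lam. Proof. by case/andP: lam01. Qed.

Let odds_powR (t : R) : c <= t <= d ->
  0 <= (t / (1 - t)) `^ lam <= (1 - d)^-1.
Proof.
move=> /andP[ct td]; rewrite powR_ge0/=.
have d0 : 0 < 1 - d by rewrite subr_gt0.
have t0 : 0 < 1 - t by rewrite subr_gt0 (le_lt_trans td).
have o0 : 0 <= t / (1 - t) by rewrite divr_ge0 ?ltW// (lt_le_trans c0).
have i1 : 1 <= (1 - d)^-1 by rewrite invf_ge1// gerBl (le_trans (ltW c0)).
have ole : t / (1 - t) <= (1 - d)^-1.
  rewrite ler_pdivrMr// mulrC ler_pdivlMr//.
  have : 0 <= t * (d - t) by rewrite mulr_ge0 ?subr_ge0// (le_trans (ltW c0)).
  have := sqr_ge0 (1 - t); rewrite !expr2; lra.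
rewrite (@le_trans _ _ ((1 - d)^-1 `^ lam))//.
  by rewrite ge0_ler_powR ?nnegrE// ?invr_ge0 ltW.
by rewrite ler1_powR// ltW//; case/andP: lam01.
Qed.

Let odds_powR_lipschitz (s t : R) : c <= s <= d -> c <= t <= d ->
  `|(s / (1 - s)) `^ lam - (t / (1 - t)) `^ lam| <=
  (1 - d)^-1 / (c * (1 - d)) * `|s - t|.
Proof.
wlog st : s t / s <= t => [H|].
  move=> sc tc; have [st|/ltW ts] := leP s t; first exact: H.
  by rewrite distrC (distrC s) H.
move=> /andP[cs sd] /andP[ct td].
have t01 u : s <= u <= t -> 0 < u < 1.
  by move=> /andP[su ut]; rewrite (lt_le_trans c0) ?(le_trans cs)//=
    (le_lt_trans ut)// (le_lt_trans td).
have E u : s <= u <= t -> (u / (1 - u)) `^ lam = expR (lam * log_odds u).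
  move=> /t01 /andP[u0 u1].
  by rewrite /powR gt_eqF// divr_gt0// subr_gt0.
have dE u : s <= u <= t -> is_derive u 1 (fun u => expR (lam * log_odds u))
   (expR (lam * log_odds u) * (lam * (u * (1 - u))^-1)).
  move=> /t01 u01; have H := is_derive_log_odds u01.
  exact: (is_derive1_comp (g := fun u : R => lam * log_odds u)
    (is_derive_expR (lam * log_odds u)) (is_deriveZ lam H)).
rewrite !E ?st ?lexx// distrC (distrC s) (@ger0_norm _ (t - s)) ?subr_ge0//.
apply: (is_derive_lipschitz st dE) => u sut; rewrite -E//.
have /andP[su ut] := sut; have /andP[u0 u1] := t01 _ sut.
have /andP[p0 p1] : 0 <= (u / (1 - u)) `^ lam <= (1 - d)^-1.
  by apply: odds_powR; rewrite (le_trans cs)// (le_trans ut).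
have u10 : 0 < u * (1 - u) by rewrite mulr_gt0// subr_gt0.
have d0 : 0 < 1 - d by rewrite subr_gt0.
rewrite ger0_norm; last by rewrite !mulr_ge0 ?(ltW lam0)// invr_ge0 ltW.
have w0 : 0 <= (u * (1 - u))^-1 by rewrite invr_ge0 ltW.
have w1 : (u * (1 - u))^-1 <= (c * (1 - d))^-1.
  have cd0 : 0 < c * (1 - d) by rewrite mulr_gt0.
  rewrite lef_pV2 ?posrE//; apply: ler_pM; rewrite ?(ltW c0) ?(ltW d0)//.
    exact: le_trans su.
  by rewrite lerB// (le_trans ut).
apply: ler_pM => //; first by rewrite mulr_ge0// ltW.
by rewrite -[leRHS]mul1r; apply: ler_pM => //; rewrite ltW//; case/andP: lam01.
Qed.

Let denom_ge (x t : R) : m <= x -> 0 <= t <= 1 -> Num.min m 1 <= (1 - t) * x + t.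
Proof.
move=> mx /andP[t0 t1]; set k := Num.min m 1.
have [km k1] : k <= m /\ k <= 1 by rewrite /k; split; rewrite ge_min lexx ?orbT.
have : (1 - t) * k <= (1 - t) * x.
  by rewrite ler_wpM2l ?subr_ge0// (le_trans km).
have : t * k <= t by rewrite ler_piMr.
lra.
Qed.

(** In this form the singularity [1 / t] at the origin has disappeared. *)
Lemma entropy_integrandE (x t : R) : 0 < x -> 0 < t < 1 ->
  entropy_integrand lam x t = (t / (1 - t)) `^ lam * ((x - 1) / ((1 - t) * x + t)).
Proof.
move=> x0 /andP[t0 t1]; rewrite /entropy_integrand; congr (_ * _).
have d0 : 0 < (1 - t) * x + t by rewrite ltr_wpDl// mulr_ge0 ?subr_ge0 ?ltW.
by field; rewrite !gt_eqF.
Qed.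

Lemma entropy_integrand_lipschitz : exists2 K : R, 0 <= K &
  forall x s t, m <= x <= M -> c <= s <= d -> c <= t <= d ->
  `|entropy_integrand lam x s - entropy_integrand lam x t| <= K * `|s - t|.
Proof.
set k := Num.min m 1; have k0 : 0 < k by rewrite lt_min m0 ltr01.
have d0 : 0 < 1 - d by rewrite subr_gt0.
have [mM|Mm] := leP m M; last first.
  exists 0 => // x s t /andP[mx xM].
  by move: (lt_le_trans Mm (le_trans mx xM)); rewrite ltxx.
have M1 : 0 <= M + 1 by rewrite addr_ge0// (le_trans (ltW m0)).
exists ((1 - d)^-1 / (c * (1 - d)) * ((M + 1) / k) + (1 - d)^-1 * ((M + 1) ^+ 2 / k ^+ 2)).
  by rewrite addr_ge0// !mulr_ge0 ?exprn_ge0 ?invr_ge0 ?mulr_ge0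
    ?exprn_ge0 ?(ltW k0) ?(ltW d0) ?(ltW c0).
move=> x s t /andP[mx xM] sc tc.
have x0 : 0 < x := lt_le_trans m0 mx.
have c01 u : c <= u <= d -> 0 < u < 1.
  by move=> /andP[cu ud]; rewrite (lt_le_trans c0)//= (le_lt_trans ud).
rewrite !entropy_integrandE ?c01//.
have D u : c <= u <= d -> k <= (1 - u) * x + u.
  by move=> /c01 /andP[u0 u1]; rewrite denom_ge// !ltW.
have Ds := D s sc; have Dt := D t tc.
set P := (s / _) `^ lam; set Q := (t / _) `^ lam.
have PQ : `|P - Q| <= (1 - d)^-1 / (c * (1 - d)) * `|s - t|.
  exact: odds_powR_lipschitz.
have /andP[Q0 Q1] : 0 <= Q <= (1 - d)^-1 by exact: odds_powR.
set a := (1 - s) * x + s in Ds *; set b := (1 - t) * x + t in Dt *.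
have a0 : 0 < a := lt_le_trans k0 Ds; have b0 : 0 < b := lt_le_trans k0 Dt.
have x1M : `|x - 1| <= M + 1 by rewrite ler_norml; apply/andP; split; lra.
have expand (p q y u v : R) : u != 0 -> v != 0 ->
    p * (y / u) - q * (y / v) = (p - q) * (y / u) + q * (y * (v - u) / (u * v)).
  by move=> u0 v0; field; rewrite u0 v0.
have -> : P * ((x - 1) / a) - Q * ((x - 1) / b) =
  (P - Q) * ((x - 1) / a) + Q * ((x - 1) * (b - a) / (a * b)).
  by rewrite expand ?gt_eqF.
have ba : b - a = (x - 1) * (s - t) by rewrite /a /b; ring.
have ik : 0 <= k^-1 by rewrite invr_ge0 ltW.
have [ia ib] : `|a^-1| <= k^-1 /\ `|b^-1| <= k^-1.
  by rewrite !normfV !gtr0_norm// !lef_pV2.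
have i1 : `|(x - 1) / a| <= (M + 1) / k by rewrite normrM ler_pM.
have i2 : `|(x - 1) / b| <= (M + 1) / k by rewrite normrM ler_pM.
rewrite (le_trans (ler_normD _ _))// [leRHS]mulrDl lerD//.
  rewrite normrM [leRHS](_ : _ =
    (1 - d)^-1 / (c * (1 - d)) * `|s - t| * ((M + 1) / k)); last by ring.
  by rewrite ler_pM.
rewrite normrM -[leRHS]mulrA ler_pM//; first by rewrite ger0_norm.
have -> : (x - 1) * (b - a) / (a * b) = ((x - 1) / a) * ((x - 1) / b) * (s - t).
  by rewrite ba; field; rewrite !gt_eqF.
rewrite normrM ler_wpM2r// normrM [leRHS](_ : _ = (M + 1) / k * ((M + 1) / k)); last first.
  by field; rewrite gt_eqF.
by rewrite ler_pM.
Qed.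

(** The constant [K] depends neither on [x] nor on the partition, which allows [x]
    to be replaced by an operator. *)
Lemma entropy_riemann_sum : exists2 K : R, 0 <= K &
  forall x, m <= x <= M -> forall delta n (y xi : nat -> R),
    tagged_partition c d n y xi ->
    (forall i, (i < n)%N -> y i.+1 - y i < delta) ->
    `|\sum_(i < n) (y i.+1 - y i) * entropy_integrand lam x (xi i) -
      (entropy_prim lam x d - entropy_prim lam x c)| <= K * delta.
Proof.
have [K K0 lipK] := entropy_integrand_lipschitz.
exists (K * (d - c)); first by rewrite mulr_ge0// subr_ge0.
move=> x xmM delta n y xi part mesh; rewrite mulrAC.
apply: (riemann_sum_primitive K0 _ _ part mesh) => [t /andP[ct td]|s t sc tc].
  apply: is_derive_entropy_prim => //; first by case/andP: xmM => /(lt_le_trans m0).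
  by rewrite (lt_le_trans c0)//= (le_lt_trans td).
exact: lipK.
Qed.

End entropy_riemann_sums.

(** * Polynomial approximation of continuous functions *)

Section weierstrass.
Context {R : realType}.

(** The Bernstein polynomial of [phi] is the expectation of [phi k] for a
    binomial [k] of parameters [n] and ['X]. Conditioning on the first trial
    gives this recursion, which makes positivity and the second moment provable
    by induction. *)
Fixpoint bernstein (n : nat) (phi : nat -> R) : {poly R} :=
  if n is n'.+1 then
    'X * bernstein n' (phi \o succn) + (1 - 'X) * bernstein n' phi
  else (phi 0%N)%:P.

Lemma bernstein_norm_le n (phi psi : nat -> R) (v x : R) : 0 <= x <= 1 ->
  (forall k, (k <= n)%N -> `|phi k - v| <= psi k) ->
  `|(bernstein n phi).[x] - v| <= (bernstein n psi).[x].
Proof.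
move=> /andP[x0 x1]; elim: n phi psi => [|n IH] phi psi H /=.
  by rewrite !hornerC H.
rewrite !hornerE.
set p := (bernstein n _).[x]; set q := (bernstein n phi).[x].
rewrite (_ : x * p + _ - v = x * (p - v) + (1 - x) * (q - v)); last by ring.
rewrite (le_trans (ler_normD _ _))// !normrM ger0_norm// (@ger0_norm _ (1 - x)) ?subr_ge0//.
by rewrite lerD// ler_wpM2l ?subr_ge0//; apply: IH => k kn; apply: H => //; exact: leqW.
Qed.

(** Mean [n x] and variance [n x (1 - x)] of the binomial law. *)
Lemma bernstein_sqr n (e K c x : R) :
  (bernstein n (fun k => e + K * (k%:R - c) ^+ 2)).[x] =
  e + K * (n%:R * x * (1 - x) + (n%:R * x - c) ^+ 2).
Proof.
elim: n c => [|n IH] c /=; first by rewrite hornerC; ring.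
rewrite !hornerE IH.
have -> : bernstein n ((fun k : nat => e + K * (k%:R - c) ^+ 2) \o succn) =
  bernstein n (fun k : nat => e + K * (k%:R - (c - 1)) ^+ 2).
  congr bernstein; apply/funext => k /=; rewrite -natr1; ring.
by rewrite IH -natr1; ring.
Qed.

(** A uniform modulus of continuity in the form that Bernstein's argument
    integrates: the quadratic term takes care of the pairs that are far apart,
    where [f] is merely bounded. *)
Lemma continuous_sqr_modulus (f : R -> R) (a b e : R) : a <= b -> 0 < e ->
  (forall x, a <= x <= b -> {for x, continuous f}) ->
  exists2 K : R, 0 <= K & forall x y, a <= x <= b -> a <= y <= b ->
    `|f x - f y| <= e + K * (x - y) ^+ 2.
Proof.
move=> ab e0 cf.
have e20 : 0 < e / 2 by rewrite divr_gt0.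
pose close (d : R) (x : R) := forall y, `|x - y| < d -> `|f x - f y| <= e.
have near_close : \forall d \near (0:R)^'+, `[a, b]%classic `<=` close d.
  have /compact_near_coveringP := @segment_compact R a b; apply.
  move=> x; rewrite /= in_itv/= => /cf /cvgrPdist_lt /(_ _ e20) /nbhs_ballP[d /= d0 fd].
  have d20 : 0 < d / 2 by rewrite divr_gt0.
  exists (ball x (d / 2), [set r : R | r < d / 2]) => /=.
    split; first exact: nbhsx_ballx.
    exact: nbhs_right_lt.
  move=> [x' r] /= [xx' rd] y x'y.
  have fx' : `|f x - f x'| < e / 2.
    by apply: fd; apply: le_ball xx'; rewrite ler_pdivrMr// ler_pMr// ler1n.
  have fy : `|f x - f y| < e / 2.
    apply: fd; rewrite /ball/= (_ : x - y = (x - x') + (x' - y)); last by ring.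
    by rewrite (le_lt_trans (ler_normD _ _))// (splitr d) ltrD// (lt_trans x'y).
  rewrite (_ : f x' - f y = - (f x - f x') + (f x - f y)); last by ring.
  by rewrite (le_trans (ler_normD _ _))// normrN (splitr e) lerD// ltW.
have [d [d0 dclose]] : exists d : R, 0 < d /\ `[a, b]%classic `<=` close d.
  near (0 : R)^'+ => d; exists d; split; first by near: d; exact: nbhs_right_gt.
  by near: d.
have cabs : {within `[a, b], continuous (fun x => `|f x|)}.
  apply: continuous_in_subspaceT => x; rewrite inE/= in_itv/= => /cf cfx.
  by apply: (@continuous_comp _ _ _ f (fun y : R => `|y|)) => //; exact: norm_continuous.
have [z _ zmax] := EVT_max ab cabs.
set B := `|f z| in zmax.
have B0 : 0 <= B := normr_ge0 _.
have C0 : 0 <= 2 * B / d ^+ 2 by apply: divr_ge0; [apply: mulr_ge0|exact: sqr_ge0].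
exists (2 * B / d ^+ 2) => // x y xab yab; have [xy|xy] := ltP `|x - y| d.
  have xin : `[a, b]%classic x by rewrite /= in_itv.
  by rewrite (le_trans (dclose x xin y xy))// lerDl mulr_ge0// sqr_ge0.
rewrite (@le_trans _ _ (2 * B))//.
  rewrite (le_trans (ler_normB _ _))// mulr_natl mulr2n lerD// zmax ?in_itv//.
have far : 1 <= (x - y) ^+ 2 / d ^+ 2.
  rewrite ler_pdivlMr ?exprn_gt0// mul1r -(real_normK (num_real (x - y))).
  by rewrite ler_sqr ?nnegrE// ltW.
have B20 : 0 <= 2 * B by exact: mulr_ge0.
rewrite ler_wpDl ?(ltW e0)// mulrAC -mulrA.
exact: ler_peMr.
Unshelve. all: by end_near. Qed.

(** Bernstein's proof: averaging the quadratic modulus of continuity over the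
    binomial law costs at most its variance, which is [O(1 / n)] after
    rescaling. *)
Lemma weierstrass (f : R -> R) (a b e : R) : a < b -> 0 < e ->
  (forall x, a <= x <= b -> {for x, continuous f}) ->
  exists p : {poly R}, forall x, a <= x <= b -> `|p.[x] - f x| <= e.
Proof.
move=> ab e0 cf; have e20 : 0 < e / 2 by rewrite divr_gt0.
have [K K0 mod] := continuous_sqr_modulus (ltW ab) e20 cf.
have l0 : 0 < b - a by rewrite subr_gt0.
set l := b - a in l0.
pose K' := K * l ^+ 2.
have K'0 : 0 <= K' by rewrite mulr_ge0 ?sqr_ge0.
have [n [n0 Kn]] : exists n : nat, 0 < n%:R :> R /\ K' / n%:R <= e / 2.
  exists (Num.trunc (K' / (e / 2))).+1; split => //.
  by rewrite ler_pdivrMr// mulrC -ler_pdivrMr// ltW// truncnS_gt.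
exists (bernstein n (fun k => f (a + l * (k%:R / n%:R))) \Po (l^-1 *: ('X - a%:P))).
move=> x /andP[ax xb]; rewrite horner_comp hornerZ hornerXsubC.
set u := l^-1 * (x - a).
have u01 : 0 <= u <= 1.
  rewrite /u mulr_ge0 ?invr_ge0 ?(ltW l0) ?subr_ge0//=.
  by rewrite ler_pdivrMl// mulr1 lerB.
have xE : x = a + l * u by rewrite /u mulrA divff ?gt_eqF// mul1r addrC subrK.
have := @bernstein_norm_le n (fun k => f (a + l * (k%:R / n%:R)))
  (fun k => e / 2 + K' / n%:R ^+ 2 * (k%:R - n%:R * u) ^+ 2) (f x) u u01.
rewrite bernstein_sqr subrr expr0n addr0 => H. apply: le_trans (H _) _ => {H}.
  move=> k kn.
  have k01 : 0 <= (k%:R / n%:R : R) <= 1.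
    by rewrite divr_ge0//= ler_pdivrMr// mul1r ler_nat.
  have kab : a <= a + l * (k%:R / n%:R) <= b.
    have /andP[k0 k1] := k01.
    rewrite lerDl mulr_ge0 ?(ltW l0)//= -lerBrDl -/l.
    by rewrite ler_piMr// ltW.
  rewrite (le_trans (mod _ x kab _)) ?ax//.
  rewrite {1}xE lerD2l le_eqVlt; apply/orP; left; apply/eqP.
  by rewrite /K'; field; rewrite gt_eqF.
have /andP[u0 u1] := u01.
rewrite [leRHS](splitr e) lerD2l (_ : K' / _ * _ = K' / n%:R * (u * (1 - u))); last first.
  by field; rewrite gt_eqF.
rewrite (le_trans _ Kn)// ler_piMr ?divr_ge0//.
by rewrite mulr_ile1 ?subr_ge0// gerBl.
Qed.

End weierstrass.

(** * Inner product, and completeness of the operator norm *)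

Local Notation "[< x , y >]" := (inner x y : complex _) (format "[< x ,  y >]").
Local Notation nr x := (complex.Re `|x|).

Lemma realcD (R : rcfType) (a b : R) : (a + b)%:C = a%:C + b%:C :> R[i].
Proof. exact: rmorphD. Qed.

Lemma realcM (R : rcfType) (a b : R) : (a * b)%:C = a%:C * b%:C :> R[i].
Proof. exact: rmorphM. Qed.

(** Norms take values in [R[i]], but errors can be taken in [R]: a positive
    element of [R[i]] is real. *)
Section real_error.
Context {R : realType} {V : normedModType R[i]}.

Lemma cvgr_real_distP {T : Type} (F : set_system T) {FF : Filter F} (u : T -> V) (l : V) :
  u @ F --> l <->
  forall e : R, 0 < e -> \forall t \near F, `|l - u t| <= e%:C.
Proof.
split=> [/cvgrPdist_le ul e e0|H]; first by apply: ul; rewrite ltcR.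
apply/cvgrPdist_le => e e0.
have eR : e = (complex.Re e)%:C by rewrite RRe_real// ger0_real// ltW.
by rewrite eR in e0 *; apply: H; rewrite -ltcR.
Qed.

Lemma le_norm_real_error (x : V) (c : R) :
  (forall e : R, 0 < e -> `|x| <= (e + c)%:C) -> `|x| <= c%:C.
Proof.
move=> H; rewrite normRe lecR; apply/ler_addgt0Pl => e e0.
by rewrite -lecR -normRe H.
Qed.

Lemma cvg_norm_le (u : nat -> V) (l : V) (c : R) :
  u n @[n --> \oo] --> l -> (\forall n \near \oo, `|u n| <= c%:C) -> `|l| <= c%:C.
Proof.
move=> /cvgr_real_distP ul uc; apply: le_norm_real_error => e e0.
have [n [uln ucn]] := filter_ex (filterI (ul e e0) uc).
rewrite -[l](subrK (u n)) (le_trans (ler_normD _ _))//.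
by rewrite realcD lerD.
Qed.

End real_error.

Section hilbert.
Context {R : realType} {H : hilbertType R}.
Implicit Types (x y z : H) (S T : 'B(H)).

Lemma innerDl x y z : [<x + y, z>] = [<x, z>] + [<y, z>].
Proof. exact: linearDl. Qed.
Lemma innerDr x y z : [<z, x + y>] = [<z, x>] + [<z, y>].
Proof. exact: linearDr. Qed.
Lemma innerBl x y z : [<x - y, z>] = [<x, z>] - [<y, z>].
Proof. exact: linearBl. Qed.
Lemma innerBr x y z : [<z, x - y>] = [<z, x>] - [<z, y>].
Proof. exact: linearBr. Qed.
Lemma innerZl k x y : [<k *: x, y>] = k * [<x, y>].
Proof. exact: linearZl_LR. Qed.
Lemma innerZr k x y : [<x, k *: y>] = k^* * [<x, y>].
Proof. exact: linearZr_LR. Qed.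
Lemma inner_conj x y : [<x, y>] = [<y, x>]^*.
Proof. by have := hermC (@inner R H) x y; rewrite expr0 mul1r. Qed.
Lemma inner_real x : [<x, x>] = (complex.Re `|x| ^+ 2)%:C.
Proof. by rewrite -sqr_norm_inner [in LHS]normRe rmorphXn. Qed.

Lemma inner0r x : [<x, 0>] = 0.
Proof. by rewrite -(scale0r 0) innerZr rmorph0 mul0r. Qed.

(** Nonnegativity of the squared norm of [|y|^2 x - <x, y> y]; this multiple of
    the projection error avoids dividing by [|y|^2]. *)
Lemma cauchy_schwarz x y : `|[<x, y>]| <= `|x| * `|y|.
Proof.
have [->|y0] := eqVneq y 0; first by rewrite inner0r !normr0 mulr0.
have ny : 0 < `|y| ^+ 2 by rewrite exprn_gt0// normr_gt0.
rewrite -(@ler_pXn2r _ 2)// ?nnegrE ?mulr_ge0//.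
set a := [<x, y>]; set n := `|y| ^+ 2 in ny.
have nc : n^* = n by apply/CrealP; rewrite ger0_real// ltW.
have := exprn_ge0 2 (normr_ge0 (n *: x - a *: y)).
rewrite sqr_norm_inner innerBl !innerBr !innerZl !innerZr.
rewrite (inner_conj y x) -/a -!sqr_norm_inner -/n nc.
have -> : n * (n * `|x| ^+ 2) - n * (a^* * a) - (a * (n * a^*) - a * (a^* * n)) =
  n * (n * `|x| ^+ 2 - a * a^*) by ring.
by rewrite -normCK pmulr_rge0// subr_ge0 exprMn mulrC.
Qed.

Lemma le_bop_norm T x : `|T x| <= `|T| * `|x|.
Proof. exact: le_opnorm. Qed.

Lemma bop_norm_le T (M : R) : 0 <= M ->
  (forall x, `|T x| <= M%:C * `|x|) -> `|T| <= M%:C.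
Proof. by move=> M0 TM; rewrite bop_normE lecR opnorm_le. Qed.

Lemma bop_normM S T : `|S * T| <= `|S| * `|T|.
Proof.
rewrite (bop_normE S) (bop_normE T) -realcM; apply: bop_norm_le.
  by rewrite mulr_ge0// opnorm_ge0.
move=> x; rewrite bopEM (le_trans (le_bop_norm _ _))// realcM -mulrA.
by rewrite ler_wpM2l// le_bop_norm.
Qed.

Lemma bop_norm1_le : `|1 : 'B(H)| <= 1.
Proof. by apply: (@bop_norm_le _ 1) => // x; rewrite mul1r. Qed.

Lemma bop_mulZl k S T : (k *: S) * T = k *: (S * T).
Proof. exact: bopP. Qed.

Lemma bop_mulZr k S T : S * (k *: T) = k *: (S * T).
Proof. by apply: bopP => x; rewrite bopEZ !bopEM bopEZ linearZ. Qed.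

Lemma cvg_bop_mul {I : Type} (F : set_system I) {FF : Filter F}
    (S_ T_ : I -> 'B(H)) S T :
  S_ @ F --> S -> T_ @ F --> T -> (fun i => S_ i * T_ i) @ F --> S * T.
Proof.
move=> /cvgr_real_distP cS /cvgr_real_distP cT; apply/cvgr_real_distP => e e0.
pose s := opnorm S + 1; pose t := opnorm T + 1.
have s0 : 0 < s by rewrite ltr_wpDl// opnorm_ge0.
have t0 : 0 < t by rewrite ltr_wpDl// opnorm_ge0.
have e1 : 0 < Num.min 1 (e / 2 / t) by rewrite lt_min ltr01 !divr_gt0.
have e2 : 0 < e / 2 / s by rewrite !divr_gt0.
near=> i.
have HS : `|S - S_ i| <= (Num.min 1 (e / 2 / t))%:C by near: i; exact: cS.
have HT : `|T - T_ i| <= (e / 2 / s)%:C by near: i; exact: cT.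
have HS1 : `|S_ i| <= s%:C.
  rewrite -[S_ i](subrK S) (le_trans (ler_normD _ _))// addrC /s realcD.
  by rewrite lerD// distrC (le_trans HS)// lecR ge_min lexx.
have -> : S * T - S_ i * T_ i = (S - S_ i) * T + S_ i * (T - T_ i).
  by rewrite mulrBl mulrBr addrA subrK.
rewrite (le_trans (ler_normD _ _))// (splitr e) realcD lerD//.
  rewrite (le_trans (bop_normM _ _))//.
  have -> : (e / 2)%:C = (e / 2 / t)%:C * t%:C by rewrite -realcM divfK ?gt_eqF.
  rewrite ler_pM//.
    by rewrite (le_trans HS)// lecR ge_min lexx orbT.
  by rewrite lecR lerDl.
rewrite (le_trans (bop_normM _ _))//.
have -> : (e / 2)%:C = s%:C * (e / 2 / s)%:C.
  by rewrite -realcM (mulrC s) divfK ?gt_eqF.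
by rewrite ler_pM.
Unshelve. all: by end_near. Qed.

(** Pointwise limits exist because [H] is complete; the Cauchy bound, being
    uniform on the unit ball, passes to the limit and gives convergence in
    norm. *)
Lemma bop_cauchy_cvg (T_ : nat -> 'B(H)) :
  (forall e : R, 0 < e -> exists N, forall m n, (N <= m)%N -> (N <= n)%N ->
     `|T_ m - T_ n| <= e%:C) ->
  exists T : 'B(H), T_ n @[n --> \oo] --> T.
Proof.
move=> cT.
have cTx x : cvg (T_ n x @[n --> \oo]).
  apply/cauchy_cvgP/cauchy_exP => e e0.
  have eR : e = (complex.Re e)%:C by rewrite RRe_real// ger0_real// ltW.
  set r := complex.Re e in eR; have r0 : 0 < r by rewrite -ltcR -eR.
  pose k := complex.Re `|x| + 1; have k0 : 0 < k by rewrite ltr_wpDl// Re_norm_ge0.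
  have [|N HN] := cT (r / 2 / k); first by rewrite !divr_gt0.
  exists (T_ N x); exists N => // n /= Nn.
  rewrite -ball_normE/= -[T_ N x - T_ n x]/((T_ N - T_ n) x).
  rewrite (le_lt_trans (le_bop_norm _ _))// eR.
  rewrite (@le_lt_trans _ _ ((r / 2 / k)%:C * k%:C))//.
    rewrite ler_pM ?HN// normRe lecR lerDl//.
  by rewrite -realcM divfK ?gt_eqF// ltcR ltr_pdivrMr// ltr_pMr// ltr1n.
pose S x := lim (T_ n x @[n --> \oo]).
have HS x : T_ n x @[n --> \oo] --> S x by exact: cTx.
have tail (e : R) : 0 < e -> exists N, forall n, (N <= n)%N ->
    forall x, `|S x - T_ n x| <= e%:C * `|x|.
  move=> e0; have [N HN] := cT e e0; exists N => n Nn x.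
  rewrite (normRe x) -realcM.
  apply: (@cvg_norm_le _ _ (fun m => T_ m x - T_ n x)).
    by apply: cvgB; [exact: HS|exact: cvg_cst].
  exists N => // m /= Nm; rewrite -[T_ m x - T_ n x]/((T_ m - T_ n) x).
  rewrite (le_trans (le_bop_norm _ _))// realcM -normRe.
  by rewrite ler_wpM2r// HN.
have Sbl : bounded_linear S.
  split.
    move=> k x y; rewrite {1}/S.
    have -> : (fun n => T_ n (k *: x + y)) = (fun n => k *: T_ n x + T_ n y).
      by apply/funext => n; rewrite linearP.
    apply: (cvg_lim (@norm_hausdorff _ _)).
    exact: (cvgD (cvgZl_tmp (k := k) (HS x)) (HS y)).
  have [N HN] := tail 1 ltr01; exists (1 + opnorm (T_ N)) => x.
  rewrite -[S x](subrK (T_ N x)) (le_trans (ler_normD _ _))//.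
  by rewrite realcD mulrDl lerD ?HN// le_bop_norm.
have SP : S \in @bop_pred R H by apply/asboolP.
exists (Bop SP); apply/cvgr_real_distP => e e0.
have [N HN] := tail e e0; exists N => // n /= Nn.
by apply: bop_norm_le; [exact: ltW|move=> x; exact: HN].
Qed.

End hilbert.

(** * Invertibility and the spectrum of a strictly positive operator *)

Section invertibility.
Context {R : realType} {H : hilbertType R}.
Implicit Types (x y : H) (S T X : 'B(H)).

Lemma invertible_op_mul S T :
  invertible_op S -> invertible_op T -> invertible_op (S * T).
Proof.
move=> [S' [SS' S'S]] [T' [TT' T'T]]; exists (T' * S'); split.
  by rewrite mulrA -(mulrA S) TT' mulr1.
by rewrite mulrA -(mulrA T') S'S mulr1.
Qed.

Lemma invertible_op_scale (k : R[i]) T : invertible_op (k *: T) -> invertible_op T.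
Proof.
move=> [B [TB BT]]; exists (k *: B); split.
  by rewrite bop_mulZr -bop_mulZl.
by rewrite bop_mulZl -bop_mulZr.
Qed.

(** The geometric series of [1 - T] converges to the inverse of [T]. *)
Lemma neumann T (q : R) : q < 1 -> `|1 - T| <= q%:C -> invertible_op T.
Proof.
move=> q1; set Q := 1 - T => Qq.
have q0 : 0 <= q by rewrite -ler0c (le_trans _ Qq).
have TE : T = 1 - Q by rewrite /Q opprB addrC subrK.
pose S_ n := \sum_(k < n) Q ^+ k.
have QX n : `|Q ^+ n| <= (q ^+ n)%:C.
  elim: n => [|n IH]; first exact: bop_norm1_le.
  by rewrite !exprS realcM (le_trans (bop_normM _ _))// ler_pM.
have dq0 : 0 < 1 - q by rewrite subr_gt0.
have S_diff n p : `|S_ (n + p)%N - S_ n| <= ((q ^+ n - q ^+ (n + p)) / (1 - q))%:C.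
  elim: p => [|p IH]; first by rewrite addn0 !subrr mul0r normr0.
  rewrite addnS {1}/S_ big_ord_recr/= addrAC (le_trans (ler_normD _ _))//.
  rewrite (_ : _ / _ = (q ^+ n - q ^+ (n + p)) / (1 - q) + q ^+ (n + p)); last first.
    by rewrite exprS; field; rewrite gt_eqF.
  by rewrite realcD lerD.
have qX0 : q ^+ n @[n --> \oo] --> (0 : R) by apply: cvg_expr; rewrite ger0_norm.
have S_diff2 N n : (N <= n)%N -> `|S_ n - S_ N| <= (q ^+ N / (1 - q))%:C.
  move=> Nn; rewrite -(subnKC Nn) (le_trans (S_diff _ _))// lecR.
  by rewrite ler_pM2r ?invr_gt0// gerBl exprn_ge0.
have [|B S_B] := @bop_cauchy_cvg R H S_.
  move=> e e0.
  have : \forall n \near \oo, q ^+ n < e * (1 - q) / 2.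
    by apply: (cvgr_lt 0) => //; rewrite divr_gt0// mulr_gt0.
  move=> [N _ HN]; exists N => m n Nm Nn.
  rewrite -(subrK (S_ N) (S_ m)) -addrA (le_trans (ler_normD _ _))//.
  rewrite (splitr e) realcD (distrC (S_ N)).
  have {}HN : q ^+ N / (1 - q) <= e / 2.
    by rewrite ler_pdivrMr// mulrAC ltW// HN/=.
  by apply: lerD; (apply: le_trans (S_diff2 _ _ _) _ => //; rewrite lecR).
have QX0 : (1 - Q ^+ n) @[n --> \oo] --> (1 : 'B(H)).
  rewrite -[X in _ --> X]subr0; apply: cvgB; first exact: cvg_cst.
  apply/cvgr_real_distP => e e0; have : \forall n \near \oo, q ^+ n < e.
    exact: (cvgr_lt 0).
  move=> [N _ HN]; exists N => // n /= Nn; rewrite sub0r normrN (le_trans (QX n))//.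
  by rewrite lecR ltW// HN.
have TS n : T * S_ n = 1 - Q ^+ n.
  elim: n => [|n IH]; first by rewrite /S_ big_ord0 mulr0 expr0 subrr.
  by rewrite /S_ big_ord_recr/= mulrDr IH TE mulrBl mul1r -exprS addrA subrK.
have ST n : S_ n * T = 1 - Q ^+ n.
  elim: n => [|n IH]; first by rewrite /S_ big_ord0 mul0r expr0 subrr.
  by rewrite /S_ big_ord_recr/= mulrDl IH TE mulrBr mulr1 -exprSr addrA subrK.
exists B; split; apply: (cvg_unique (@norm_hausdorff _ _) _ QX0).
  rewrite -(funext TS : (fun n => T * S_ n) = _).
  by apply: cvg_bop_mul => //; exact: cvg_cst.
rewrite -(funext ST : (fun n => S_ n * T) = _).
by apply: cvg_bop_mul => //; exact: cvg_cst.
Qed.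

Lemma sqr_norm_sub x y : nr (x - y) ^+ 2 = nr x ^+ 2 - 2 * complex.Re [<y, x>] + nr y ^+ 2.
Proof.
apply: (@complexI R); rewrite -inner_real innerBl !innerBr !inner_real.
rewrite (inner_conj x y); case: [<y, x>] => a b /=.
by apply/eqP; rewrite eq_complex /=; apply/andP; split; apply/eqP; ring.
Qed.

(** For a small [tau > 0] the operator [1 - tau k T] is a strict contraction:
    [|x - tau k T x|^2 <= (1 - 2 tau b + tau^2 K^2) |x|^2], and the right-hand
    side is smallest at [tau = b / K^2]. The scalar [k] rotates the numerical
    range of [T] into a right half-plane. *)
Lemma lax_milgram T (k : R[i]) (b : R) : 0 < b ->
  (forall x, b * nr x ^+ 2 <= complex.Re (k * [<T x, x>])) -> invertible_op T.
Proof.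
move=> b0 coer; apply: (@invertible_op_scale k).
(* Adding b keeps K positive and makes 1 - b^2 / K^2 nonnegative. *)
set U := k *: T; pose K := opnorm U + b.
have K0 : 0 < K by rewrite ltr_wpDl// opnorm_ge0.
have K20 : 0 < K ^+ 2 by rewrite exprn_gt0.
pose tau := b / K ^+ 2; have tau0 : 0 < tau by rewrite divr_gt0.
apply: (@invertible_op_scale tau%:C).
pose s := 1 - b ^+ 2 / K ^+ 2.
have s0 : 0 <= s.
  rewrite subr_ge0 ler_pdivrMr// mul1r ler_sqr ?nnegrE ?(ltW b0) ?(ltW K0)//.
  by rewrite /K lerDr opnorm_ge0.
have s1 : Num.sqrt s < 1.
  by rewrite -[ltRHS]sqrtr1 ltr_sqrt// gtrBl divr_gt0// exprn_gt0.
apply: (neumann s1); apply: bop_norm_le; first exact: sqrtr_ge0.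
move=> x; rewrite [leLHS]normRe [X in _ * X]normRe -realcM lecR.
rewrite -ler_sqr ?nnegrE ?mulr_ge0 ?sqrtr_ge0 ?Re_norm_ge0// exprMn sqr_sqrtr//.
have -> : (1 - tau%:C *: U) x = x - tau%:C *: U x by [].
rewrite sqr_norm_sub innerZl.
have -> : complex.Re (tau%:C * [<U x, x>]) = tau * complex.Re [<U x, x>].
  by case: [<_, _>] => u v; rewrite /= mul0r subr0.
have -> : nr (tau%:C *: U x) = tau * nr (U x).
  by rewrite normrZ ger0_norm ?ler0c ?(ltW tau0)// (normRe (U x)) -realcM.
have Ux : nr (U x) <= K * nr x.
  rewrite -lecR realcM -!normRe (le_trans (le_bop_norm _ _))// ler_wpM2r//.
  by rewrite lecR lerDl ltW.
have c1 : b * nr x ^+ 2 <= complex.Re [<U x, x>].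
  by rewrite (le_trans (coer x))// /U bopEZ innerZl.
have c2 : nr (U x) ^+ 2 <= K ^+ 2 * nr x ^+ 2.
  by rewrite -exprMn ler_sqr ?nnegrE ?mulr_ge0 ?(ltW K0) ?Re_norm_ge0.
have c3 : tau * (b * nr x ^+ 2) <= tau * complex.Re [<U x, x>] by rewrite ler_pM2l.
have c4 : tau ^+ 2 * nr (U x) ^+ 2 <= tau ^+ 2 * (K ^+ 2 * nr x ^+ 2).
  by rewrite ler_pM2l// exprn_gt0.
have -> : s * nr x ^+ 2 =
  nr x ^+ 2 - 2 * (tau * (b * nr x ^+ 2)) + tau ^+ 2 * (K ^+ 2 * nr x ^+ 2).
  by rewrite /s /tau; field; rewrite gt_eqF.
by rewrite exprMn lerD// lerB// ler_pM2l.
Qed.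

(** Off the real line and on the negative half-line, a multiple of [X - z] is
    coercive. Above the norm of [X], and near [0] after multiplication by the
    inverse of [X], a Neumann series inverts [X - z]. *)
Lemma spectrum_strictly_positive X : strictly_positive X ->
  exists m M : R, [/\ 0 < m, m < M &
    forall z, spectrum X z -> z = (complex.Re z)%:C /\ m <= complex.Re z <= M].
Proof.
move=> [[_ Xpos] [B [XB BX]]].
pose m : R := (2 * (opnorm B + 1))^-1.
have B1 : 0 < opnorm B + 1 by rewrite ltr_wpDl// opnorm_ge0.
have m0 : 0 < m by rewrite invr_gt0 mulr_gt0.
pose M := opnorm X + m + 1.
exists m, M; split => //.
  by rewrite /M -addrA addrCA ltrDl ltr_wpDl// opnorm_ge0.
move=> z specz.
have Xre x : exists2 r : R, 0 <= r & [<X x, x>] = r%:C.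
  exists (complex.Re [<X x, x>]); last by rewrite RRe_real// ger0_real.
  by rewrite -ler0c RRe_real// ger0_real.
have inner_shift (k : R[i]) x (r : R) : [<X x, x>] = r%:C ->
    [<(X - k *: (1 : 'B(H))) x, x>] = r%:C - k * (nr x ^+ 2)%:C.
  by move=> E; rewrite -E -inner_real -innerZl -innerBl.
have Im0 : complex.Im z = 0.
  apply/eqP/negPn/negP => Imz; apply: specz.
  apply: (@lax_milgram _ ('i * (complex.Im z)%:C) (complex.Im z ^+ 2)).
    by rewrite lt0r sqrf_eq0 Imz sqr_ge0.
  move=> x; have [r r0 E] := Xre x; rewrite (inner_shift _ _ _ E).
  by case: (z) => a b /=; rewrite le_eqVlt; apply/orP; left; apply/eqP; ring.
have zE : z = (complex.Re z)%:C by case: (z) Im0 => a b /= ->.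
split => //; rewrite {1}zE in specz.
move: {Im0 zE}(complex.Re z) specz => a specz.
have a0 : 0 <= a.
  rewrite leNgt; apply/negP => a0; apply: specz.
  apply: (@lax_milgram _ 1 (- a)); first by rewrite oppr_gt0.
  move=> x; have [r r0 E] := Xre x; rewrite (inner_shift _ _ _ E) /=.
  rewrite !(mul0r, mulr0, mul1r, subr0, oppr0, addr0); lra.
apply/andP; split; rewrite leNgt; apply/negP => am; apply: specz.
  have -> : X - a%:C *: (1 : 'B(H)) = (1 - a%:C *: B) * X.
    by rewrite mulrBl mul1r bop_mulZl BX.
  apply: invertible_op_mul; last by exists B.
  apply: (@neumann _ 2^-1); first by rewrite invf_lt1// ltr1n.
  rewrite opprB addrC subrK normrZ bop_normE ger0_norm ?ler0c// -realcM lecR.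
  rewrite (@le_trans _ _ (m * (opnorm B + 1)))//.
    by apply: ler_pM; rewrite ?opnorm_ge0 ?(ltW am) ?lerDl.
  by rewrite /m le_eqVlt; apply/orP; left; apply/eqP; field; rewrite gt_eqF.
have M0 : 0 < M by rewrite /M ltr_wpDl// addr_ge0 ?opnorm_ge0 ?(ltW m0).
have a1 : 0 < a := lt_trans M0 am.
apply: (@invertible_op_scale (- a^-1)%:C).
apply: (@neumann _ (opnorm X / a)).
  rewrite ltr_pdivrMr// mul1r (lt_trans _ am)// /M -addrA ltrDl addr_gt0//.
have aV : (- a^-1)%:C * a%:C = -1 :> R[i].
  by rewrite -realcM mulNr mulVf ?gt_eqF// rmorphN rmorph1.
rewrite scalerBr scalerA aV scaleN1r opprK opprD addrCA subrr addr0.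
rewrite normrN normrZ bop_normE ler0_norm.
  by rewrite -rmorphN opprK -realcM lecR mulrC.
by rewrite -[0]/(0%:C) lecR oppr_le0 invr_ge0.
Qed.

End invertibility.

(** * Polynomials of a self-adjoint operator *)

Section poly_op.
Context {R : realType} {H : hilbertType R}.
Implicit Types (x y : H) (S T X : 'B(H)) (p q : {poly R[i]}).

Lemma poly_op_sum n p X : (size p <= n)%N -> poly_op p X = \sum_(k < n) p`_k *: X ^+ k.
Proof.
move=> pn; rewrite /poly_op -(subnKC pn) big_split_ord/= [X in _ + X]big1 ?addr0//.
by move=> k _; rewrite nth_default ?scale0r// leq_addr.
Qed.

Lemma poly_opD p q X : poly_op (p + q) X = poly_op p X + poly_op q X.
Proof.
pose n := maxn (size p) (size q).
rewrite !(@poly_op_sum n) ?size_polyD ?leq_maxl ?leq_maxr// -big_split/=.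
by apply: eq_bigr => k _; rewrite coefD scalerDl.
Qed.

Lemma poly_opZ c p X : poly_op (c *: p) X = c *: poly_op p X.
Proof.
rewrite !(@poly_op_sum (size p)) ?size_scale_leq// scaler_sumr.
by apply: eq_bigr => k _; rewrite coefZ scalerA.
Qed.

Lemma poly_opB p q X : poly_op (p - q) X = poly_op p X - poly_op q X.
Proof. by rewrite -scaleN1r poly_opD poly_opZ scaleN1r. Qed.

Lemma poly_opC c X : poly_op c%:P X = c *: (1 : 'B(H)).
Proof.
by rewrite (@poly_op_sum 1) ?size_polyC ?leq_b1// big_ord1 coefC eqxx expr0.
Qed.

Lemma poly_opMX p X : poly_op (p * 'X) X = poly_op p X * X.
Proof.
rewrite (@poly_op_sum (size p).+1); last first.
  by rewrite (leq_trans (size_polyMleq _ _))// size_polyX addn2.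
rewrite big_ord_recl coefMX eqxx scale0r add0r /poly_op mulr_suml.
by apply: eq_bigr => k _; rewrite coefMX/= bop_mulZl -exprSr.
Qed.

Lemma poly_opX X : poly_op 'X X = X.
Proof. by rewrite -['X]mul1r poly_opMX (poly_opC 1) scale1r mul1r. Qed.

Lemma poly_opM p q X : poly_op (p * q) X = poly_op p X * poly_op q X.
Proof.
elim/poly_ind: q => [|q c IH].
  by rewrite mulr0 -polyC0 poly_opC scale0r mulr0.
rewrite mulrDr mulrA !poly_opD !poly_opMX IH poly_opC mulrDr -mulrA.
by rewrite -[p * _]mulrC mul_polyC poly_opZ bop_mulZr mulr1.
Qed.

Lemma is_adjoint_poly_op p X : self_adjoint X ->
  is_adjoint (poly_op p X) (poly_op (map_poly Num.conj p) X).
Proof.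
move=> saX; elim/poly_ind: p => [|p c IH] x y.
  rewrite rmorph0 -polyC0 !poly_opC !bopEZ !scale0r inner0r.
  by rewrite -(scale0r x) innerZl mul0r.
have comm q : poly_op q X * X = X * poly_op q X.
  by rewrite -poly_opMX mulrC poly_opM poly_opX.
rewrite rmorphD rmorphM/= map_polyX map_polyC/=.
rewrite !poly_opD !poly_opMX !poly_opC [in RHS]comm.
by rewrite !bopED !bopEM !bopEZ !bopE1 innerDl innerDr IH saX innerZl innerZr conjCK.
Qed.

Lemma adjoint_norm_le S T : is_adjoint S T -> `|T| <= `|S|.
Proof.
move=> ST; rewrite (bop_normE S); apply: bop_norm_le; first exact: opnorm_ge0.
move=> y; have [->|Ty0] := eqVneq (T y) 0;
  first by rewrite normr0 mulr_ge0// ler0c opnorm_ge0.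
have Ty : 0 < `|T y| by rewrite normr_gt0.
rewrite -(ler_pM2l Ty) -expr2 sqr_norm_inner -ST.
have S0 : 0 <= [<S (T y), y>] by rewrite ST -sqr_norm_inner exprn_ge0.
rewrite -(ger0_norm S0) (le_trans (cauchy_schwarz _ _))// mulrA ler_wpM2r//.
by rewrite mulrC le_bop_norm.
Qed.

(** The square of the norm of [S] is a spectral value of [S^* S]. A bounded
    inverse would give [|x|^2 <= c (M^2 |x|^2 - |S x|^2)] for all [x], that is
    [|S x|^2 <= (M^2 - 1 / c) |x|^2], against the minimality of [M]. The nonzero
    vector excludes the zero space, on which every operator is invertible. *)
Lemma adjoint_mul_sub_sqr_norm_singular (x0 : H) S T : x0 != 0 -> is_adjoint S T ->
  ~ invertible_op (T * S - (opnorm S ^+ 2)%:C *: (1 : 'B(H))).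
Proof.
move=> x0n ST [B [_ BU]]; set M := opnorm S in BU *.
set U := _ - _ in BU.
have M0 : 0 <= M := opnorm_ge0 _.
have TM : opnorm T <= M by rewrite -lecR -!bop_normE adjoint_norm_le.
have nx0 : 0 < nr x0 by rewrite -ltcR -normRe normr_gt0.
(* The summand 1 only ensures that c is positive. *)
pose c := opnorm B ^+ 2 * M ^+ 2 + 1.
have c0 : 0 < c by rewrite ltr_wpDl// mulr_ge0 ?sqr_ge0.
have SM x : nr (S x) <= M * nr x.
  by rewrite -lecR realcM -!normRe le_opnorm.
have key x : nr x ^+ 2 <= c * (M ^+ 2 * nr x ^+ 2 - nr (S x) ^+ 2).
  have D0 : 0 <= M ^+ 2 * nr x ^+ 2 - nr (S x) ^+ 2.
    by rewrite subr_ge0 -exprMn ler_sqr ?nnegrE ?mulr_ge0 ?Re_norm_ge0.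
  have xB : nr x <= opnorm B * nr (U x).
    by rewrite -lecR realcM -!normRe -{1}(bopE1 x) -BU bopEM le_opnorm.
  have UE : U x = T (S x) - (M ^+ 2)%:C *: x by [].
  have UM : nr (U x) ^+ 2 <= M ^+ 2 * (M ^+ 2 * nr x ^+ 2 - nr (S x) ^+ 2).
    rewrite UE sqr_norm_sub innerZl.
    have -> : [<x, T (S x)>] = (nr (S x) ^+ 2)%:C by rewrite -ST inner_real.
    rewrite -realcM/=.
    have -> : nr ((M ^+ 2)%:C *: x) = M ^+ 2 * nr x.
      by rewrite normrZ ger0_norm ?ler0c ?sqr_ge0// (normRe x) -realcM.
    have TS : nr (T (S x)) ^+ 2 <= M ^+ 2 * nr (S x) ^+ 2.
      rewrite -exprMn ler_sqr ?nnegrE ?mulr_ge0 ?Re_norm_ge0//.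
      rewrite -lecR realcM -!normRe (le_trans (le_opnorm _ _))// ler_wpM2r//.
      by rewrite lecR.
    move: TS; rewrite exprMn.
    move: (nr (T (S x)) ^+ 2) (nr (S x) ^+ 2) (nr x ^+ 2) (M ^+ 2).
    by move=> u v w k; lra.
  rewrite (@le_trans _ _ (opnorm B ^+ 2 * nr (U x) ^+ 2))//.
    by rewrite -exprMn ler_sqr ?nnegrE ?mulr_ge0 ?Re_norm_ge0 ?opnorm_ge0.
  rewrite (@le_trans _ _ (opnorm B ^+ 2 *
      (M ^+ 2 * (M ^+ 2 * nr x ^+ 2 - nr (S x) ^+ 2))))//.
    by rewrite ler_wpM2l// sqr_ge0.
  by rewrite mulrA ler_wpM2r// lerDl.
have key2 x : nr (S x) ^+ 2 <= (M ^+ 2 - c^-1) * nr x ^+ 2.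
  have := key x; rewrite mulrC -ler_pdivrMr// mulrBl (mulrC c^-1); lra.
have s0 : 0 <= M ^+ 2 - c^-1.
  have := le_trans (sqr_ge0 _) (key2 x0).
  by rewrite pmulr_lge0// exprn_gt0.
have : M <= Num.sqrt (M ^+ 2 - c^-1).
  apply: opnorm_le; first exact: sqrtr_ge0.
  move=> x; rewrite (normRe x) (normRe (S x)) -realcM lecR.
  rewrite -ler_sqr ?nnegrE ?mulr_ge0 ?sqrtr_ge0 ?Re_norm_ge0// exprMn sqr_sqrtr//.
rewrite -ler_sqr ?nnegrE ?sqrtr_ge0// sqr_sqrtr// lerBrDr gerDl.
by rewrite leNgt invr_gt0 c0.
Qed.

(** Over the algebraically closed field [R[i]], [p(X)] is a product of factors
    [X - z]; if it is not invertible, one of them is not. *)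
Lemma spectrum_root p X : p != 0 -> ~ invertible_op (poly_op p X) ->
  exists2 z, spectrum X z & root p z.
Proof.
move=> p0 ninv; have [s ps] := closed_field_poly_normal p.
have [[z zs specz]|Hn] := pselect (exists2 z, z \in s & spectrum X z).
  by exists z => //; rewrite ps rootZ ?lead_coef_eq0// root_prod_XsubC.
exfalso; apply: ninv; rewrite ps poly_opZ.
apply: (@invertible_op_scale _ _ (lead_coef p)^-1).
rewrite scalerA mulVf ?lead_coef_eq0// scale1r.
have {}Hn z : z \in s -> invertible_op (X - z *: (1 : 'B(H))).
  by move=> zs; apply: contrapT => nz; apply: Hn; exists z.
elim: s Hn {ps} => [|z s IH] Hn.
  by rewrite big_nil (poly_opC 1) scale1r; exists 1; split; rewrite mulr1.
rewrite big_cons poly_opM; apply: invertible_op_mul.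
  by rewrite poly_opB poly_opX poly_opC; apply: Hn; rewrite mem_head.
by apply: IH => w ws; apply: Hn; rewrite inE ws orbT.
Qed.

(** The square of the norm of [p(X)] is a value of [p^* p] at a spectral value
    [z] of [X], by the two preceding lemmas, and for a real [z] this is
    [|p(z)|^2]. *)
Lemma poly_op_norm_le p X (K : R) : self_adjoint X ->
  (forall z, spectrum X z -> z^* = z) -> 0 <= K ->
  (forall z, spectrum X z -> `|p.[z]| <= K%:C) -> `|poly_op p X| <= K%:C.
Proof.
move=> saX specR K0 pK.
have [[x0 x0n]|Hn] := pselect (exists x0 : H, x0 != 0); last first.
  apply: bop_norm_le => // x; have -> : x = 0.
    by apply/eqP/negPn/negP => x0; apply: Hn; exists x.
  by rewrite linear0 normr0 mulr0.
have singular q : ~ invertible_op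
    (poly_op (map_poly Num.conj q * q - ((opnorm (poly_op q X)) ^+ 2)%:C%:P) X).
  rewrite poly_opB poly_opM poly_opC.
  exact: (adjoint_mul_sub_sqr_norm_singular x0n (is_adjoint_poly_op q saX)).
(* The spectrum is nonempty: apply the same argument to the polynomial 'X. *)
have [w specw] : exists w, spectrum X w.
  have r0 : map_poly Num.conj ('X : {poly R[i]}) * 'X -
      ((opnorm (poly_op 'X X)) ^+ 2)%:C%:P != 0.
    rewrite map_polyX -expr2 -size_poly_eq0 size_polyDl ?size_polyXn//.
    by rewrite size_polyN size_polyC; case: eqP.
  by have [w sw _] := spectrum_root r0 (singular 'X); exists w.
set r := map_poly Num.conj p * p - ((opnorm (poly_op p X)) ^+ 2)%:C%:P.
have [z specz rz] : exists2 z, spectrum X z & root r z.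
  have [r0|r0] := eqVneq r 0; first by exists w => //; rewrite r0 root0.
  exact: spectrum_root r0 (singular p).
have : `|p.[z]| ^+ 2 = `|poly_op p X| ^+ 2.
  move: rz; rewrite /root /r !hornerE -{1}(specR _ specz) horner_map.
  rewrite [X in X - _]mulrC -normCK subr_eq0 => /eqP ->.
  by rewrite bop_normE -rmorphXn.
move/eqP; rewrite eqrXn2// => /eqP <-; exact: pK.
Qed.

End poly_op.

(** * Continuous functional calculus *)

Section functional_calculus.
Context {R : realType} {H : hilbertType R}.
Variables (X : 'B(H)) (m M : R).
Hypotheses (saX : self_adjoint X) (mM : m < M)
  (specX : forall z, spectrum X z ->
     z = (complex.Re z)%:C /\ m <= complex.Re z <= M).
Implicit Types (Y Z : 'B(H)) (f g : R -> R).

Let spec_norm_le (p : {poly R[i]}) (K : R) : 0 <= K ->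
  (forall z, spectrum X z -> `|p.[z]| <= K%:C) -> `|poly_op p X| <= K%:C.
Proof.
apply: poly_op_norm_le => // z /specX[-> _].
by rewrite -[RHS]conjc_real.
Qed.

Lemma is_cfc_norm_le (F : R[i] -> R[i]) Y (K : R) : is_cfc X F Y -> 0 <= K ->
  (forall z, spectrum X z -> `|F z| <= K%:C) -> `|Y| <= K%:C.
Proof.
move=> [p [pF pY]] K0 FK; apply: le_norm_real_error => e e0.
apply: (cvg_norm_le pY); have := pF e e0; apply: filterS => n pn.
apply: spec_norm_le => [|z sz]; first by rewrite addr_ge0// ltW.
rewrite -[_.[z]](subrK (F z)) (le_trans (ler_normD _ _))//.
by rewrite realcD lerD ?pn ?FK.
Qed.

Lemma is_cfcB (F G : R[i] -> R[i]) Y Z : is_cfc X F Y -> is_cfc X G Z ->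
  is_cfc X (fun z => F z - G z) (Y - Z).
Proof.
move=> [p [pF pY]] [q [qG qZ]]; exists (fun n => p n - q n); split.
  move=> e e0; have e2 : 0 < e / 2 by rewrite divr_gt0.
  near=> n => z sz; rewrite hornerD hornerN (splitr e) realcD.
  rewrite (_ : _ - _ - _ = (p n).[z] - F z - ((q n).[z] - G z)); last by ring.
  rewrite (le_trans (ler_normB _ _))// lerD//.
    by move: z sz; near: n; exact: pF.
  by move: z sz; near: n; exact: qG.
rewrite (_ : (fun n => _) = (fun n => poly_op (p n) X - poly_op (q n) X)); last first.
  by apply/funext => n; rewrite poly_opB.
exact: cvgB.
Unshelve. all: by end_near. Qed.

(** A common bound of the two functions makes the products of the approximating
    polynomials converge uniformly. *)
Lemma is_cfcM (F G : R[i] -> R[i]) Y Z (K : R) : 0 <= K ->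
  (forall z, spectrum X z -> `|F z| <= K%:C) ->
  (forall z, spectrum X z -> `|G z| <= K%:C) ->
  is_cfc X F Y -> is_cfc X G Z -> is_cfc X (fun z => F z * G z) (Y * Z).
Proof.
move=> K0 FK GK [p [pF pY]] [q [qG qZ]]; exists (fun n => p n * q n); split.
  move=> e e0; pose k := K + 1; have k0 : 0 < k by rewrite ltr_wpDl.
  pose d := Num.min 1 (e / 2 / k).
  have d0 : 0 < d by rewrite lt_min ltr01 !divr_gt0.
  have dk : d%:C * k%:C <= (e / 2)%:C.
    by rewrite -realcM lecR -ler_pdivlMr// ge_min lexx orbT.
  near=> n.
  have Ap z : spectrum X z -> `|(p n).[z] - F z| <= d%:C.
    by move: z; near: n; exact: pF.
  have Aq z : spectrum X z -> `|(q n).[z] - G z| <= d%:C.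
    by move: z; near: n; exact: qG.
  move=> z sz; have Hp := Ap z sz; have Hq := Aq z sz.
  have pk : `|(p n).[z]| <= k%:C.
    rewrite -[_.[z]](subrK (F z)) (le_trans (ler_normD _ _))// addrC realcD.
    by rewrite lerD ?FK// (le_trans Hp)// lecR ge_min lexx.
  have gk : `|G z| <= k%:C by rewrite (le_trans (GK _ sz))// lecR lerDl.
  rewrite hornerM (_ : _ - _ =
    ((p n).[z] - F z) * G z + ((q n).[z] - G z) * (p n).[z]); last by ring.
  rewrite (le_trans (ler_normD _ _))// (splitr e) realcD !normrM.
  by apply: lerD; apply: le_trans dk; apply: ler_pM.
rewrite (_ : (fun n => _) = (fun n => poly_op (p n) X * poly_op (q n) X)); last first.
  by apply/funext => n; rewrite poly_opM.
exact: cvg_bop_mul.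
Unshelve. all: by end_near. Qed.

Lemma is_cfc_poly (p : {poly R[i]}) : is_cfc X (horner p) (poly_op p X).
Proof.
exists (fun=> p); split; last exact: cvg_cst.
by move=> e e0; near=> n => z _; rewrite subrr normr0 ler0c ltW.
Unshelve. all: by end_near. Qed.

Lemma is_cfc_ext (F G : R[i] -> R[i]) Y :
  (forall z, spectrum X z -> F z = G z) -> is_cfc X F Y -> is_cfc X G Y.
Proof.
move=> FG [p [pF pY]]; exists p; split=> // e e0.
by have := pF e e0; apply: filterS => n pn z sz; rewrite -FG// pn.
Qed.

(** The norm estimate applied to the zero function. *)
Lemma is_cfc_unique (F : R[i] -> R[i]) Y Z : is_cfc X F Y -> is_cfc X F Z -> Y = Z.
Proof.
move=> FY FZ; apply/eqP; rewrite -subr_eq0 -normr_le0.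
apply: (@is_cfc_norm_le _ _ 0 (is_cfcB FY FZ)) => // z _.
by rewrite subrr normr0.
Qed.

(** The calculus for real functions of a real variable, extended to [R[i]]
    through the real part: on the spectrum of [X], which is real, this is
    harmless. *)
Definition is_rcfc f Y := is_cfc X (fun z => (f (complex.Re z))%:C) Y.

Lemma cfcE f Y : is_rcfc f Y -> cfc X (fun z => (f (complex.Re z))%:C) = Y.
Proof.
move=> fY; apply: xget_subset1 => // Z Z' FZ FZ'; exact: is_cfc_unique FZ FZ'.
Qed.

Lemma norm_realc (r : R) : `|r%:C| = `|r|%:C :> R[i].
Proof.
have [r0|/ltW r0] := leP 0 r; first by rewrite !ger0_norm ?ler0c.
rewrite (ler0_norm r0) ler0_norm ?rmorphN//.
by rewrite -[0]/(0%:C) lecR.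
Qed.

Lemma rcfc_norm_le f Y (K : R) : is_rcfc f Y -> 0 <= K ->
  (forall x, m <= x <= M -> `|f x| <= K) -> `|Y| <= K%:C.
Proof.
move=> fY K0 fK; apply: (is_cfc_norm_le fY) => // z /specX[_ mz].
by rewrite norm_realc lecR fK.
Qed.

Lemma rcfc_ext f g Y : (forall x, m <= x <= M -> f x = g x) ->
  is_rcfc f Y -> is_rcfc g Y.
Proof. by move=> fg; apply: is_cfc_ext => z /specX[_ mz]; rewrite fg. Qed.

Lemma rcfcB f g Y Z : is_rcfc f Y -> is_rcfc g Z -> is_rcfc (f \- g) (Y - Z).
Proof.
move=> fY gZ; apply: is_cfc_ext (is_cfcB fY gZ) => z _.
by rewrite /= rmorphB.
Qed.

Lemma rcfc_cst (c : R) : is_rcfc (cst c) (c%:C *: (1 : 'B(H))).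
Proof.
rewrite -(poly_opC _ X); apply: is_cfc_ext (is_cfc_poly _) => z _.
by rewrite hornerC.
Qed.

Lemma rcfc_id : is_rcfc id X.
Proof.
rewrite -[X in is_rcfc _ X]poly_opX; apply: is_cfc_ext (is_cfc_poly _) => z.
by move=> /specX[zE _]; rewrite hornerX.
Qed.

Lemma continuous_bounded f : (forall x, m <= x <= M -> {for x, continuous f}) ->
  exists2 K : R, 0 <= K & forall x, m <= x <= M -> `|f x| <= K.
Proof.
move=> cf; have [K K0 fK] := continuous_sqr_modulus (ltW mM) ltr01 cf.
exists (`|f m| + (1 + K * (M - m) ^+ 2)).
  by rewrite !addr_ge0// mulr_ge0// sqr_ge0.
move=> x xmM; rewrite -[f x](subrK (f m)) addrC (le_trans (ler_normD _ _))// lerD//.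
have mmM : m <= m <= M by rewrite lexx ltW.
rewrite (le_trans (fK x m xmM mmM))// lerD2l ler_wpM2l//.
have /andP[mx xM] := xmM.
by rewrite ler_sqr ?nnegrE ?subr_ge0 ?(ltW mM)// lerB.
Qed.

Lemma rcfcM f g Y Z :
  (forall x, m <= x <= M -> {for x, continuous f}) ->
  (forall x, m <= x <= M -> {for x, continuous g}) ->
  is_rcfc f Y -> is_rcfc g Z -> is_rcfc (f \* g) (Y * Z).
Proof.
move=> /continuous_bounded[K K0 fK] /continuous_bounded[L L0 gL] fY gZ.
have KL0 : 0 <= K + L by rewrite addr_ge0.
have := @is_cfcM _ _ Y Z _ KL0 _ _ fY gZ => FG.
apply: is_cfc_ext (FG _ _) => z; first by rewrite /= rmorphM.
  by move=> /specX[_ mz]; rewrite norm_realc lecR (le_trans (fK _ mz))// lerDl.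
by move=> /specX[_ mz]; rewrite norm_realc lecR (le_trans (gL _ mz))// lerDr.
Qed.

Lemma rcfcZ (c : R) f Y : is_rcfc f Y -> is_rcfc (fun x => c * f x) (c%:C *: Y).
Proof.
move=> [p [pF pY]]; exists (fun n => c%:C *: p n); split.
  move=> e e0; have c0 : 0 < `|c| + 1 by rewrite ltr_wpDl.
  have d0 : 0 < e / (`|c| + 1) by rewrite divr_gt0.
  have := pF _ d0; apply: filterS => n pn z sz.
  rewrite hornerZ rmorphM/= -mulrBr normrM norm_realc.
  rewrite (@le_trans _ _ ((`|c| + 1)%:C * (e / (`|c| + 1))%:C))//.
    by rewrite ler_pM ?pn// ?ler0c// lecR lerDl.
  by rewrite -realcM mulrC divfK ?gt_eqF.
rewrite (_ : (fun n => _) = (fun n => c%:C *: poly_op (p n) X)); last first.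
  by apply/funext => n; rewrite poly_opZ.
exact: cvgZl_tmp.
Qed.

Lemma rcfcD f g Y Z : is_rcfc f Y -> is_rcfc g Z -> is_rcfc (f \+ g) (Y + Z).
Proof.
move=> fY gZ; have := rcfcB fY (rcfcZ (-1) gZ).
rewrite rmorphN rmorph1 scaleN1r opprK; apply: rcfc_ext => x _ /=; ring.
Qed.

Lemma rcfc_sum n (f : nat -> R -> R) (Y : nat -> 'B(H)) :
  (forall i, (i < n)%N -> is_rcfc (f i) (Y i)) ->
  is_rcfc (fun x => \sum_(i < n) f i x) (\sum_(i < n) Y i).
Proof.
elim: n => [|n IH] fY.
  rewrite big_ord0 -(scale0r (1 : 'B(H))); have := rcfc_cst 0; apply: rcfc_ext => x _.
  by rewrite big_ord0.
have := rcfcD (IH (fun i ni => fY i (leqW ni))) (fY n (leqnn _)).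
by rewrite big_ord_recr/=; apply: rcfc_ext => x _ /=; rewrite big_ord_recr.
Qed.

(** Polynomials approximating [f] uniformly form a uniform Cauchy sequence on the
    spectrum, so their values at [X] form a Cauchy sequence of operators. They
    can be taken real, hence with self-adjoint values at [X]. *)
Lemma rcfc_exists f : (forall x, m <= x <= M -> {for x, continuous f}) ->
  exists2 Y, is_rcfc f Y & self_adjoint Y.
Proof.
move=> cf.
have /choice[p pf] (n : nat) : exists p : {poly R},
    forall x, m <= x <= M -> `|p.[x] - f x| <= n.+1%:R^-1.
  by apply: weierstrass => //; rewrite invr_gt0.
pose P n := map_poly (real_complex R) (p n).
have PE n z : spectrum X z -> (P n).[z] = ((p n).[complex.Re z])%:C.
  by move=> /specX[zE _]; rewrite zE /P horner_map.
have Pf n z : spectrum X z -> `|(P n).[z] - (f (complex.Re z))%:C| <= (n.+1%:R^-1)%:C.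
  move=> sz; rewrite PE// -rmorphB/= norm_realc lecR pf//.
  by have [] := specX sz.
have small (e : R) : 0 < e -> exists N, forall n, (N <= n)%N -> n.+1%:R^-1 <= e.
  move=> e0; exists (Num.trunc e^-1) => n Nn.
  rewrite -[e]invrK lef_pV2 ?posrE ?invr_gt0//.
  by rewrite ltW// (lt_le_trans (truncnS_gt _))// ler_nat.
have [|Y PY] := @bop_cauchy_cvg R H (fun n => poly_op (P n) X).
  move=> e e0; have e2 : 0 < e / 2 by rewrite divr_gt0.
  have [N HN] := small _ e2; exists N => k n Nk Nn.
  rewrite -poly_opB; apply: spec_norm_le => [|z sz]; first exact: ltW.
  rewrite hornerD hornerN.
  rewrite (_ : _ - _ = (P k).[z] - (f (complex.Re z))%:C -
    ((P n).[z] - (f (complex.Re z))%:C)); last by ring.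
  rewrite (le_trans (ler_normB _ _))// (splitr e) realcD.
  by apply: lerD; apply: le_trans (Pf _ _ sz) _; rewrite lecR HN.
exists Y.
  exists P; split => // e e0; have [N HN] := small _ e0.
  exists N => // n /= Nn z sz.
  by rewrite (le_trans (Pf _ _ sz))// lecR HN.
have saP n : self_adjoint (poly_op (P n) X).
  have := is_adjoint_poly_op (P n) saX.
  rewrite /P -map_poly_comp (_ : map_poly _ _ = map_poly (real_complex R) (p n))//.
  by apply: eq_map_poly => x; exact: conjc_real.
move=> x y; apply/eqP; rewrite -subr_eq0 -normr_le0.
apply: (@le_norm_real_error R R[i]^o _ 0) => e e0; rewrite addr0.
pose c := complex.Re `|x| * complex.Re `|y| + 1.
have c0 : 0 < c by rewrite ltr_wpDl// mulr_ge0// Re_norm_ge0.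
have d0 : 0 < e / 2 / c by rewrite !divr_gt0.
have [n Hn] := filter_ex ((cvgr_real_distP _ _).1 PY _ d0).
set Q := poly_op (P n) X in Hn.
have half u v : `|u| * `|v| = `|x| * `|y| -> `|inner ((Y - Q) u) v| <= (e / 2)%:C :> R[i].
  move=> uv; rewrite (le_trans (cauchy_schwarz _ _))//.
  rewrite (@le_trans _ _ ((e / 2 / c)%:C * (`|u| * `|v|)))//.
    rewrite mulrA ler_wpM2r// (le_trans (le_bop_norm _ _))// ler_wpM2r//.
  rewrite uv (normRe x) (normRe y) -!realcM lecR.
  rewrite (@le_trans _ _ (e / 2 / c * c))//; last by rewrite divfK ?gt_eqF.
  by rewrite ler_pM2l// lerDl.
have -> : inner (Y x) y - inner x (Y y) =
    inner ((Y - Q) x) y - (inner ((Y - Q) y) x)^*.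
  rewrite -inner_conj -[(Y - Q) x]/(Y x - Q x) -[(Y - Q) y]/(Y y - Q y).
  by rewrite innerBl innerBr (saP n) opprB addrA subrK.
rewrite (le_trans (ler_normB _ _))// (splitr e) realcD lerD ?half//.
by rewrite norm_conjC half// mulrC.
Qed.

End functional_calculus.

(** * Operator means and the operator integral *)

Section strictly_positive.
Context {R : realType} {H : hilbertType R}.
Implicit Types A B S T X Y : 'B(H).

Lemma inv_opE A B : is_inverse A B -> inv_op A = B.
Proof.
move=> AB; apply: xget_subset1 => // B1 B2 [_ B1A] [AB2 _].
by rewrite -[B1]mulr1 -AB2 mulrA B1A mul1r.
Qed.

Lemma continuous_powR_pos (r x : R) : 0 < x -> {for x, continuous (@powR R ^~ r)}.
Proof.
move=> x0; apply: differentiable_continuous; apply/derivable1_diffP.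
have D := is_derive1_powR r x0; exact: ex_derive.
Qed.

(** Multiplicativity of the calculus, applied to powers of exponent [1/2] and
    [-1/2] on a segment of the positive half-line. *)
Lemma power_op_half X : strictly_positive X ->
  let S := power_op X (1 / 2) in let T := power_op X (- (1 / 2)) in
  [/\ S * S = X, is_inverse S T & self_adjoint T].
Proof.
move=> Xpos S T.
have [m [M [m0 mM specX]]] := spectrum_strictly_positive Xpos.
have saX : self_adjoint X by case: Xpos => -[].
have pos x : m <= x <= M -> 0 < x by move=> /andP[/(lt_le_trans m0)].
have cont r x : m <= x <= M -> {for x, continuous (@powR R ^~ r)}.
  by move=> /pos; exact: continuous_powR_pos.
have [S' S'P _] := rcfc_exists saX mM specX (cont (1 / 2)).
have [T' T'P saT] := rcfc_exists saX mM specX (cont (- (1 / 2))).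
have -> : S = S' by exact: (cfcE saX specX S'P).
have -> : T = T' by exact: (cfcE saX specX T'P).
have uniq f Y Z : is_rcfc X f Y -> is_rcfc X f Z -> Y = Z.
  exact: (is_cfc_unique saX specX).
split => //.
  apply: uniq (rcfcM mM specX (cont _) (cont _) S'P S'P) _.
  apply: (rcfc_ext specX) (rcfc_id specX) => x /pos x0 /=.
  rewrite -powRD; last by rewrite gt_eqF ?implybT.
  by rewrite -splitr powRr1// ltW.
have E x : m <= x <= M -> x `^ (1 / 2) * x `^ (- (1 / 2)) = 1.
  by move=> /pos x0; rewrite powRN mulfV// gt_eqF// powR_gt0.
have cst1 : is_rcfc X (cst 1) (1 : 'B(H)).
  by have := rcfc_cst X 1; rewrite scale1r.
split.
  apply: uniq (rcfcM mM specX (cont _) (cont _) S'P T'P) _.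
  by apply: (rcfc_ext specX) cst1 => x xm; rewrite /= E.
apply: uniq (rcfcM mM specX (cont _) (cont _) T'P S'P) _.
by apply: (rcfc_ext specX) cst1 => x xm; rewrite /= mulrC E.
Qed.

Lemma strictly_positive_conj B S T : strictly_positive B -> is_inverse S T ->
  self_adjoint T -> strictly_positive (T * B * T).
Proof.
move=> [[saB posB] [B' [BB' B'B]]] [ST TS] saT; split; first split.
- by move=> x y; rewrite !bopEM saT saB saT.
- by move=> x; rewrite !bopEM saT; exact: posB.
- exists (S * B' * S); split.
    by rewrite !mulrA -(mulrA (T * B)) TS mulr1 -(mulrA T) BB' mulr1 TS.
  by rewrite !mulrA -(mulrA (S * B')) ST mulr1 -(mulrA S) B'B mulr1 ST.
Qed.

(** With [D = (1 - t) C + t], conjugation by [T] gives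
    [(1 - t) A^-1 + t B^-1 = T D C^-1 T], whose inverse is [S (C D^-1) S]. The two
    equations on [Y] say that [Y = C D^-1]. *)
Lemma harmonic_meanE A B S T Y (C : 'B(H)) (t : R) :
  A = S * S -> B = S * C * S -> is_inverse S T -> invertible_op C ->
  Y * ((1 - t)%:C *: C + t%:C *: (1 : 'B(H))) = C ->
  ((1 - t)%:C *: C + t%:C *: (1 : 'B(H))) * Y = C ->
  Defs.harmonic_mean t A B = S * Y * S.
Proof.
move=> -> -> [ST TS] [C' [CC' C'C]] YD DY; rewrite /Defs.harmonic_mean.
have -> : inv_op (S * S) = T * T.
  apply: inv_opE; split; rewrite mulrA.
    by rewrite -(mulrA S) ST mulr1.
  by rewrite -(mulrA T) TS mulr1.
have -> : inv_op (S * C * S) = T * C' * T.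
  apply: inv_opE; split; rewrite !mulrA.
    by rewrite -(mulrA (S * C)) ST mulr1 -(mulrA S) CC' mulr1.
  by rewrite -(mulrA (T * C')) TS mulr1 -(mulrA T) C'C mulr1.
apply: inv_opE.
have DT : (1 - t)%:C *: (T * T) + t%:C *: (T * C' * T) =
    T * (((1 - t)%:C *: C + t%:C *: (1 : 'B(H))) * C') * T.
  rewrite mulrDl !bop_mulZl CC' mul1r mulrDr mulrDl !bop_mulZr !bop_mulZl.
  by rewrite mulr1.
have DC' : ((1 - t)%:C *: C + t%:C *: (1 : 'B(H))) * C' =
    C' * ((1 - t)%:C *: C + t%:C *: (1 : 'B(H))).
  by rewrite mulrDl mulrDr !bop_mulZl !bop_mulZr CC' C'C mul1r mulr1.
rewrite DT; split.
  rewrite DC' !mulrA -(mulrA _ T S) TS mulr1 -(mulrA (T * C')) DY.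
  by rewrite -(mulrA T) C'C mulr1.
by rewrite !mulrA -(mulrA (S * Y)) ST mulr1 -(mulrA S) YD -(mulrA S) CC' mulr1.
Qed.

End strictly_positive.

Section riemann_integral.
Context {R : realType} {V : normedModType R[i]}.
Implicit Types (F : R -> V) (a b : R) (I J : V).

Lemma tagged_partition_fine a b (d : R) : a <= b -> 0 < d ->
  exists n (x : nat -> R), tagged_partition a b n x x /\
    forall i, (i < n)%N -> x i.+1 - x i < d.
Proof.
move=> ab d0; pose n := (Num.trunc ((b - a) / d)).+1.
have n0 : 0 < n%:R :> R by [].
have nd : (b - a) / n%:R < d.
  by rewrite ltr_pdivrMr// mulrC -ltr_pdivrMr// truncnS_gt.
have step i : a + (b - a) * (i.+1%:R / n%:R) -
    (a + (b - a) * (i%:R / n%:R)) = (b - a) / n%:R.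
  by rewrite -natr1; field; rewrite gt_eqF.
exists n, (fun i => a + (b - a) * (i%:R / n%:R)); split; last by move=> i _; rewrite step.
split; first by rewrite mul0r mulr0 addr0.
  by rewrite divff ?gt_eqF// mulr1 addrC subrK.
by move=> i _; rewrite lexx/= -subr_ge0 step divr_ge0// subr_ge0.
Qed.

(** Two integrals of [F] are compared through one Riemann sum of small mesh. *)
Lemma is_integral_unique F a b I J : a <= b ->
  is_integral F a b I -> is_integral F a b J -> I = J.
Proof.
move=> ab FI FJ; apply/eqP; rewrite -subr_eq0 -normr_le0.
apply: (@le_norm_real_error R V _ 0) => e e0; rewrite addr0.
have e2 : 0 < e / 2 by rewrite divr_gt0.
have [d1 d10 H1] := FI _ e2; have [d2 d20 H2] := FJ _ e2.
have d0 : 0 < Num.min d1 d2 by rewrite lt_min d10.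
have [n [x [xP mesh]]] := tagged_partition_fine ab d0.
have I1 : `|riemann_sum F n x x - I| < (e / 2)%:C.
  by apply: H1 => // i ni; rewrite (lt_le_trans (mesh i ni))// ge_min lexx.
have I2 : `|riemann_sum F n x x - J| < (e / 2)%:C.
  by apply: H2 => // i ni; rewrite (lt_le_trans (mesh i ni))// ge_min lexx orbT.
rewrite (_ : I - J = riemann_sum F n x x - J - (riemann_sum F n x x - I)); last first.
  by rewrite opprB [RHS]addrC addrA subrK.
rewrite (le_trans (ler_normB _ _))// (splitr e) realcD.
by rewrite lerD// ltW.
Qed.

Lemma integralE F a b I : a <= b -> is_integral F a b I -> Defs.integral F a b = I.
Proof.
by move=> ab FI; apply: xget_subset1 => // J K; exact: is_integral_unique.
Qed.

Lemma improper_integralE F a b I : is_improper_integral F a b I ->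
  improper_integral F a b = I.
Proof.
move=> FI; apply: xget_subset1 => // J K [_ FJ] [_ FK].
exact: (cvg_unique (@norm_hausdorff _ _) FJ FK).
Qed.

End riemann_integral.

Section tsallis.
Context {R : realType} {H : hilbertType R}.
Variables (A B : 'B(H)) (lam : R).
Hypotheses (Apos : strictly_positive A) (Bpos : strictly_positive B)
  (lam0 : 0 < lam) (lam1 : lam < 1).

Let S := power_op A (1 / 2).
Let T := power_op A (- (1 / 2)).
Let C := T * B * T.

Let SS : S * S = A. Proof. by have [] := power_op_half Apos. Qed.
Let ST : is_inverse S T. Proof. by have [] := power_op_half Apos. Qed.

Let SCS : B = S * C * S.
Proof.
have [ST1 TS1] := ST.
by rewrite /C !mulrA ST1 mul1r -mulrA TS1 mulr1.
Qed.

Let Cpos : strictly_positive C.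
Proof. by apply: strictly_positive_conj Bpos ST _; have [] := power_op_half Apos. Qed.

Let saC : self_adjoint C. Proof. by case: Cpos => -[]. Qed.

Variables (m M : R).
Hypotheses (m0 : 0 < m) (mM : m < M) (specC : forall z, spectrum C z ->
  z = (complex.Re z)%:C /\ m <= complex.Re z <= M).

Let pos x : m <= x <= M -> 0 < x.
Proof. by move=> /andP[/(lt_le_trans m0)]. Qed.

Lemma tsallis_integrandE (t : R) : 0 < t < 1 ->
  exists2 Z, is_rcfc C (fun x => entropy_integrand lam x t) Z &
    tsallis_integrand lam A B t = S * Z * S.
Proof.
move=> /andP[t0 t1].
have D0 x : 0 < x -> 0 < (1 - t) * x + t.
  by move=> x0; rewrite ltr_wpDl// mulr_ge0 ?subr_ge0// ltW.
have dD (x : R) : is_derive x 1 (fun x : R => (1 - t) * x + t) (1 - t).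
  have H1 := is_deriveZ (1 - t) (is_derive_id x (1 : R)).
  have H2 := is_derive_cst t x (1 : R).
  by apply: (is_derive_eq (is_deriveD H1 H2)); rewrite addr0 /GRing.scale/= mulr1.
have cD x : m <= x <= M -> {for x, continuous (fun x : R => (1 - t) * x + t)}.
  move=> _; apply: differentiable_continuous; apply/derivable1_diffP.
  by have D := dD x; exact: ex_derive.
have cg x : m <= x <= M -> {for x, continuous (fun x : R => x / ((1 - t) * x + t))}.
  move=> /pos x0; apply: differentiable_continuous; apply/derivable1_diffP.
  pose g (x : R) := (1 - t) * x + t.
  have g0 : g x != 0 by rewrite gt_eqF// D0.
  have D := is_deriveM (is_derive_id x (1 : R)) (is_deriveV g0 (dD x)).
  exact: ex_derive.
have [Y YP _] := rcfc_exists saC mM specC cg.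
have DP : is_rcfc C (fun x : R => (1 - t) * x + t) ((1 - t)%:C *: C + t%:C *: (1 : 'B(H))).
  exact: (rcfcD specC (rcfcZ (1 - t) (rcfc_id specC)) (rcfc_cst C t)).
have uniq f Y1 Y2 : is_rcfc C f Y1 -> is_rcfc C f Y2 -> Y1 = Y2.
  exact: (is_cfc_unique saC specC).
have hm : Defs.harmonic_mean t A B = S * Y * S.
  apply: (harmonic_meanE (esym SS) SCS ST); first by case: Cpos.
    apply: uniq (rcfcM mM specC cg cD YP DP) _.
    apply: (rcfc_ext specC) (rcfc_id specC) => x /pos x0 /=.
    by rewrite divfK// gt_eqF// D0.
  apply: uniq (rcfcM mM specC cD cg DP YP) _.
  apply: (rcfc_ext specC) (rcfc_id specC) => x /pos x0 /=.
  by rewrite mulrC divfK// gt_eqF// D0.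
pose P := (t / (1 - t)) `^ lam.
exists (P%:C *: ((t^-1)%:C *: (Y - 1%:C *: (1 : 'B(H))))).
  exact: (rcfcZ P (rcfcZ t^-1 (rcfcB YP (rcfc_cst C 1)))).
rewrite /tsallis_integrand hm -/P !bop_mulZr !bop_mulZl scale1r mulrBr mulrBl mulr1.
by rewrite SS.
Qed.

(** The operator [h_t(C)]. *)
Let Zf (t : R) : 'B(H) :=
  xget 0 [set Z | is_rcfc C (fun x => entropy_integrand lam x t) Z /\
    tsallis_integrand lam A B t = S * Z * S].

Let ZfP (t : R) : 0 < t < 1 ->
  is_rcfc C (fun x => entropy_integrand lam x t) (Zf t) /\
    tsallis_integrand lam A B t = S * Zf t * S.
Proof.
move=> /tsallis_integrandE [Z ZP tZ].
by apply: (@xgetPex _ 0 [set Z | is_rcfc C _ Z /\ _ = S * Z * S]); exists Z.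
Qed.

Let norm_SZS Z : `|S * Z * S| <= (opnorm S ^+ 2)%:C * `|Z|.
Proof.
rewrite (le_trans (bop_normM _ _))// expr2 realcM mulrAC ler_wpM2r//.
exact: bop_normM.
Qed.

(** The Riemann sums of the operator integrand are the images of scalar Riemann
    sums under the calculus of [C], conjugated by [S]; they converge because the
    scalar ones do so uniformly on [m, M]. *)
Lemma tsallis_is_integral (c d : R) : 0 < c -> c <= d -> d < 1 ->
  exists2 G, is_rcfc C (fun x => entropy_prim lam x d - entropy_prim lam x c) G &
    is_integral (tsallis_integrand lam A B) c d (S * G * S).
Proof.
move=> c0 cd d1.
have cont t x : m <= x <= M -> {for x, continuous (entropy_prim lam ^~ t)}.
  by move=> /pos x0; exact: continuous_entropy_prim.
have [Gd GdP _] := rcfc_exists saC mM specC (cont d).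
have [Gc GcP _] := rcfc_exists saC mM specC (cont c).
exists (Gd - Gc); first exact: rcfcB.
have lam01 : 0 < lam < 1 by rewrite lam0.
have [K K0 HK] := entropy_riemann_sum M lam01 c0 cd d1 m0.
move=> e e0; pose s := opnorm S ^+ 2; have s0 : 0 <= s := sqr_ge0 _.
have k0 : 0 < s * K + 1 by rewrite ltr_wpDl// mulr_ge0.
(* The summand 1 keeps the denominator positive and the final estimate strict. *)
exists (e / (s * K + 1)); first by rewrite divr_gt0.
move=> n y xi part mesh.
have xi01 i : (i < n)%N -> 0 < xi i < 1.
  move=> ni; have [y0 yn yxi] := part; have /andP[yx xy] := yxi _ ni.
  rewrite (lt_le_trans c0) ?(le_lt_trans _ d1)//.
    by rewrite (le_trans xy)// -yn; apply: (tagged_partition_mono part); rewrite ni/=.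
  by rewrite (le_trans _ yx)// -y0; apply: (tagged_partition_mono part); rewrite /= ltnW.
pose Q := \sum_(i < n) (y i.+1 - y i)%:C *: Zf (xi i).
have -> : riemann_sum (tsallis_integrand lam A B) n y xi = S * Q * S.
  rewrite /riemann_sum /Q mulr_sumr mulr_suml; apply: eq_bigr => i _.
  by rewrite bop_mulZr bop_mulZl (ZfP (xi01 _ (ltn_ord i))).2.
rewrite -mulrBl -mulrBr (le_lt_trans (norm_SZS _))//.
have QP : is_rcfc C (fun x =>
    \sum_(i < n) (y i.+1 - y i) * entropy_integrand lam x (xi i)) Q.
  apply: (rcfc_sum specC (f := fun i x => (y i.+1 - y i) * entropy_integrand lam x (xi i))
    (Y := fun i => (y i.+1 - y i)%:C *: Zf (xi i))) => i ni.
  exact: (rcfcZ _ (ZfP (xi01 _ ni)).1).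
have Kd0 : 0 <= K * (e / (s * K + 1)) by rewrite mulr_ge0// divr_ge0// ltW.
have QG : `|Q - (Gd - Gc)| <= (K * (e / (s * K + 1)))%:C.
  apply: (rcfc_norm_le saC specC (rcfcB QP (rcfcB GdP GcP)) Kd0) => x xmM.
  exact: HK.
rewrite (le_lt_trans (ler_wpM2l _ QG)) ?ler0c// -realcM ltcR.
rewrite -/s (mulrA s K) (mulrCA (s * K)).
by rewrite gtr_pMr// ltr_pdivrMr// mul1r ltrDl.
Qed.

(** Used at both ends: with [s = c] near [0], and with [s = 1 - d] near [1]. *)
Lemma odds_powR_small (mu e : R) : 0 < mu -> 0 < e ->
  exists2 dl : R, 0 < dl & forall s, 0 < s -> s < dl ->
    s <= 1 / 2 /\ (s / (1 - s)) `^ mu <= e.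
Proof.
move=> mu0 e0; pose eta := e `^ mu^-1; have eta0 : 0 < eta by exact: powR_gt0.
exists (Num.min (1 / 2) (eta / 2)); first by rewrite lt_min !divr_gt0.
move=> s s0; rewrite lt_min => /andP[s1 s2]; split; first exact: ltW.
have -> : e = eta `^ mu by rewrite /eta -powRrM mulVf ?gt_eqF// powRr1// ltW.
have s3 : 0 < 1 - s by lra.
have d0 : 0 <= s / (1 - s) by rewrite divr_ge0 ?ltW.
rewrite ge0_ler_powR ?nnegrE ?(ltW mu0) ?(ltW eta0)//.
rewrite ler_pdivrMr//.
have : eta * (1 / 2) <= eta * (1 - s) by rewrite ler_pM2l//; lra.
lra.
Qed.

Let Climit : 'B(H) := (logistic_mass lam)%:C *: (power_op C lam - 1).

(** The integral over [c, d] is the image of [G_x(d) - G_x(c)], which tends to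
    [k (x^lam - 1)] uniformly on [m, M] by the two end point estimates. *)
Lemma tsallis_is_improper_integral :
  is_improper_integral (tsallis_integrand lam A B) 0 1 (S * Climit * S).
Proof.
split=> [c d c0 cd d1|].
  by have [G _ GI] := tsallis_is_integral c0 cd d1; exists (S * G * S).
have regroup (u v w : R) : u - (v - w) = - (v - u) + w by ring.
have half_le (u v : R) : u <= 1 / 2 -> 1 - v <= 1 / 2 -> u <= v by lra.
have lam01 : 0 < lam < 1 by rewrite lam0.
have lam10 : 0 < 1 - lam by rewrite subr_gt0.
have ClimitP : is_rcfc C (fun x => logistic_mass lam * (x `^ lam - 1)) Climit.
  have cont x : m <= x <= M -> {for x, continuous (@powR R ^~ lam)}.
    by move=> /pos; exact: continuous_powR_pos.
  have [L LP _] := rcfc_exists saC mM specC cont.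
  rewrite /Climit (_ : power_op C lam = L); last exact: (cfcE saC specC LP).
  by have := rcfcZ (logistic_mass lam) (rcfcB LP (rcfc_cst C 1)); rewrite scale1r.
apply/cvgr_real_distP => e e0.
pose s := opnorm S ^+ 2; have s0 : 0 <= s := sqr_ge0 _.
pose k := s * ((M + 1) / (1 - lam) + 2 / lam) + 1.
have M0 : 0 < M := lt_trans m0 mM.
have M10 : 0 <= M + 1 by rewrite addr_ge0// ltW.
have k1 : 0 <= (M + 1) / (1 - lam) := divr_ge0 M10 (ltW lam10).
have k2 : 0 <= 2 / lam by rewrite divr_ge0// ltW.
have k0 : 0 < k by rewrite ltr_wpDl// mulr_ge0// addr_ge0.
have ek : 0 < e / k by rewrite divr_gt0.
have [d1 d10 H1] := odds_powR_small lam0 ek.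
have [d2 d20 H2] := odds_powR_small lam10 ek.
exists ([set c : R | 0 < c < d1], [set d : R | 1 - d2 < d < 1]).
  split=> /=.
    near=> c; rewrite /= ; apply/andP; split; near: c.
      exact: nbhs_right_gt.
    exact: nbhs_right_lt.
  near=> d; rewrite /=; apply/andP; split; near: d.
    by apply: nbhs_left_gt; rewrite gtrBl.
  exact: nbhs_left_lt.
move=> [c d] [/= /andP[c0 cd1] /andP[dd2 dl1]].
have [c12 cle] := H1 _ c0 cd1.
have d0' : 0 < 1 - d by rewrite subr_gt0.
have d2' : 1 - d < d2 by rewrite ltrBlDr -ltrBlDl.
have [d12 dle] := H2 (1 - d) d0' d2'.
have cd : c <= d := half_le _ _ c12 d12.
have [G GP GI] := tsallis_is_integral c0 cd dl1.
rewrite (integralE cd GI) -mulrBl -mulrBr (le_trans (norm_SZS _))//.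
have b0 : 0 <= ((M + 1) / (1 - lam) + 2 / lam) * (e / k).
  by rewrite mulr_ge0 ?addr_ge0// ltW.
have bound : `|Climit - G| <= (((M + 1) / (1 - lam) + 2 / lam) * (e / k))%:C.
  apply: (rcfc_norm_le saC specC (rcfcB ClimitP GP) b0) => x xmM /=.
  have x0 := pos xmM; have /andP[mx xM] := xmM.
  have d01 : 0 < d < 1 by rewrite dl1 (lt_le_trans c0).
  have c01 : 0 < c < 1 by rewrite c0 (le_lt_trans cd).
  rewrite regroup.
  rewrite (le_trans (ler_normD _ _))// normrN [leRHS]mulrDl lerD//.
    rewrite (le_trans (entropy_prim_right lam01 x0 d01))// ler_pM//.
    - by rewrite divr_ge0 ?(ltW lam10)// addr_ge0// ltW.
    - exact: powR_ge0.
    - by rewrite ler_pM2r ?invr_gt0// lerD2r.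
    - by rewrite subKr in dle.
  by rewrite (le_trans (entropy_prim_left lam0 x0 c01))// ler_wpM2l.
rewrite (le_trans (ler_wpM2l _ bound)) ?ler0c// -realcM lecR.
rewrite -/s (mulrA s) (mulrCA (s * _)) ler_piMr ?(ltW e0)// ler_pdivrMr// mul1r.
by rewrite /k lerDl.
Unshelve. all: by end_near. Qed.

Lemma tsallis_accretiveE :
  tsallis_accretive lam A B = tsallis_positive lam A B.
Proof.
rewrite /tsallis_accretive (improper_integralE tsallis_is_improper_integral).
rewrite /tsallis_positive /geometric_mean -/S -/T -/C.
rewrite /Climit bop_mulZr bop_mulZl scalerA -realcM.
rewrite mulrBr mulr1 mulrBl SS; congr (_%:C *: _).
have lam01 : 0 < lam < 1 by rewrite lam0.
by rewrite mulrAC logistic_massE// invfM mulrCA mulfV ?mulr1// gt_eqF// pi_gt0.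
Qed.

End tsallis.

Theorem proposition3p3 (R : realType) (H : hilbertType R) (A B : 'B(H)) (lam : R)
    (Apos : strictly_positive A) (Bpos : strictly_positive B)
    (lam0 : 0 < lam) (lam1 : lam < 1) :
  (exists I : 'B(H),
     is_improper_integral (tsallis_integrand lam A B) 0 1 I) /\
  tsallis_accretive lam A B = tsallis_positive lam A B.
Proof.
have [_ ST saT] := power_op_half Apos.
have [m [M [m0 mM specC]]] :=
  spectrum_strictly_positive (strictly_positive_conj Bpos ST saT).
split; last exact: (tsallis_accretiveE Apos Bpos lam0 lam1 m0 mM specC).
by eexists; exact: (tsallis_is_improper_integral Apos Bpos lam0 lam1 m0 mM specC).
Qed.
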